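(* Assume that $N\geq d+1$. (1) A random $\mathcal{A}=(A_j)_{j=1}^N$ in $\mathbf{H}_d(\mathbb{R})^N$ chosen under any absolutely continuous distribution has the almost everywhere phase retrieval property in $\mathbb{R}^d$ with probability one. (2) More generally, let $1\le r_1,\dots,r_N\le d$ and for each $j$ let $V_j\subset \mathbf{H}_d(\mathbb{R})$ be either the set of all rank $r_j$ symmetric matrices or the set of all rank $r_j$ orthogonal projection matrices. Then a generic $\mathcal{A}=(A_j)_{j=1}^N\in V_1\times\cdots\times V_N$ has the almost everywhere phase retrieval property in $\mathbb{R}^d$.
   Context: $\mathbf{H}_d(\mathbb{R})$ is the set of real symmetric $d\times d$ matrices; absolute continuity is with respect to Lebesgue measure on the real vector space $\mathbf{H}_d(\mathbb{R})^N$. For $\mathcal{A}=(A_j)_{j=1}^N\in \mathbf{H}_d(\mathbb{R})^N$ define $\mathbf{M}_{\mathcal{A}}(x)=(x^{T}A_1x,\dots,x^{T}A_Nx)\in\mathbb{R}^N$ for $x\in\mathbb{R}^d$. $\mathcal{A}$ has the almost everywhere phase retrieval property in $\mathbb{R}^d$ if for Lebesgue-almost every $x\in\mathbb{R}^d$ the following holds: whenever $y\in\mathbb{R}^d$ satisfies $\mathbf{M}_{\mathcal{A}}(y)=\mathbf{M}_{\mathcal{A}}(x)$, then $y=x$ or $y=-x$. An orthogonal projection matrix is a matrix $P$ with $P=P^{T}=P^2$. A property holds for a generic element of $V=V_1\times\cdots\times V_N$ if it holds for all elements of $V$ outside a subset of $V$ cut out by real polynomial equations whose real dimension is strictly smaller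 than that of $V$.
   Formalization: In (2), for d ≥ 2, it is assumed that at least d of the sets V_j differ from {I} (the rank d orthogonal projections); without this the claim is false, e.g. d = 2, N = 3 and all V_j = {I}, and no A in V has the property when it fails. *)

(* Defs.v *)
From HB Require Import structures.
From mathcomp Require Import all_boot all_order all_algebra.
From mathcomp Require Import all_classical all_reals all_analysis.
From mathcomp Require mpoly.
(* The notations of mpoly clash with those of mathcomp-analysis. *)
Import (canonicals, coercions) mpoly.

Set Implicit Arguments.
Unset Strict Implicit.
Unset Printing Implicit Defensive.

Import Order.TTheory GRing.Theory Num.Theory.
Import numFieldNormedType.Exports.

Local Open Scope classical_set_scope.
Local Open Scope ring_scope.

Lemma product_sigma_finite d1 d2 (T1 : measurableType d1)
    (T2 : measurableType d2) (R : realType)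
    (m1 : {sigma_finite_measure set T1 -> \bar R})
    (m2 : {sigma_finite_measure set T2 -> \bar R}) :
  sigma_finite setT (m1 \x m2)%E.
Proof.
have /sigma_finiteP[F [TF ndF Foo]] := sigma_finiteT m1.
have /sigma_finiteP[G [TG ndG Goo]] := sigma_finiteT m2.
exists (fun n => F n `*` G n).
  rewrite -setXTT TF TG predeqE => -[x y]; split=> [|[n _ []/= ? ?]].
    move=> [/= [n _ Fnx] [k _ Gky]]; exists (maxn n k) => //; split.
    - by move: x Fnx; exact/subsetPset/ndF/leq_maxl.
    - by move: y Gky; exact/subsetPset/ndG/leq_maxr.
  by split; exists n.
move=> k; have [? ?] := Foo k; have [? ?] := Goo k.
split; first exact: measurableX.
by rewrite product_measure1E// lte_mul_pinfty// ge0_fin_numE.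
Qed.

Section LebesgueTuple.
Context {R : realType}.
Local Notation mR := (measurableTypeR R).

Definition tuple_cons n (p : mR * n.-tuple mR) : n.+1.-tuple mR :=
  [tuple of p.1 :: p.2].

Definition tuple_uncons n (t : n.+1.-tuple mR) : mR * n.-tuple mR :=
  (thead t, [tuple of behead t]).

Lemma tuple_consK n : cancel (@tuple_cons n) (@tuple_uncons n).
Proof. by case=> x t; congr (_, _); apply/val_inj. Qed.

Lemma measurable_tuple_cons n : measurable_fun setT (@tuple_cons n).
Proof. exact: (measurable_cons (@measurable_fst _ _ _ _) (@measurable_snd _ _ _ _)). Qed.

Lemma measurable_tuple_uncons n : measurable_fun setT (@tuple_uncons n).
Proof.
apply/measurable_fun_pairP; split; last exact: measurable_behead.
exact: measurable_tnth.
Qed.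

Section Step.
Variables (n : nat) (m : {sigma_finite_measure set (n.-tuple mR) -> \bar R}).

Definition lebesgue_cons : set (n.+1.-tuple mR) -> \bar R :=
  pushforward (lebesgue_measure \x m)%E (@tuple_cons n).

Let lebesgue_cons0 : lebesgue_cons set0 = 0%E.
Proof. by rewrite /lebesgue_cons /pushforward preimage_set0 measure0. Qed.

Let lebesgue_cons_ge0 A : (0 <= lebesgue_cons A)%E.
Proof. by rewrite /lebesgue_cons /pushforward; exact: measure_ge0. Qed.

Let lebesgue_cons_sigma_additive : semi_sigma_additive lebesgue_cons.
Proof.
move=> F mF tF mUF; rewrite /lebesgue_cons /pushforward preimage_bigcup.
have mcons A : measurable A -> measurable (@tuple_cons n @^-1` A).
  by move=> mA; rewrite -[X in measurable X]setTI; exact: measurable_tuple_cons.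
apply: measure_semi_sigma_additive.
- by move=> k; exact: mcons.
- apply/trivIsetP => /= i j _ _ ij; rewrite -preimage_setI.
  by move/trivIsetP : tF => /(_ _ _ _ _ ij) ->//; rewrite preimage_set0.
- by rewrite -preimage_bigcup; exact: mcons.
Qed.

HB.instance Definition _ := isMeasure.Build _ _ _ lebesgue_cons
  lebesgue_cons0 lebesgue_cons_ge0 lebesgue_cons_sigma_additive.

Let lebesgue_cons_sigma_finite : sigma_finite setT lebesgue_cons.
Proof.
have [F FT Foo] := product_sigma_finite (@lebesgue_measure R) m.
exists (fun k => @tuple_uncons n @^-1` F k).
  by rewrite -preimage_bigcup -FT preimage_setT.
move=> k; have [mF Fk] := Foo k; split.
  by rewrite -[X in measurable X]setTI; exact: measurable_tuple_uncons.
rewrite /lebesgue_cons /pushforward -comp_preimage.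
by rewrite (_ : _ \o _ = id) //; apply/funext => p /=; exact: tuple_consK.
Qed.

HB.instance Definition _ := Measure_isSigmaFinite.Build _ _ _ lebesgue_cons
  lebesgue_cons_sigma_finite.

End Step.

Fixpoint lebesgue_tuple n : {sigma_finite_measure set (n.-tuple mR) -> \bar R} :=
  if n is n'.+1 then lebesgue_cons (lebesgue_tuple n')
  else \d_[tuple].

Lemma lebesgue_tuple_box n (B : 'I_n -> set mR) :
  (forall i, measurable (B i)) ->
  lebesgue_tuple n [set t | forall i, B i (tnth t i)] =
  (\prod_(i < n) lebesgue_measure (B i))%E.
Proof.
elim: n B => [|n IHn] B mB.
  by rewrite big_ord0 /= diracE mem_set // => -[].
rewrite big_ord_recl -IHn//= /lebesgue_cons /pushforward.
rewrite -product_measure1E//; last first.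
  rewrite (_ : [set _ | _] = \big[setI/setT]_(i < n)
      ((@tnth n mR ^~ i) @^-1` B (lift ord0 i))).
    apply: bigsetI_measurable => i _.
    by rewrite -[X in measurable X]setTI; exact: measurable_tnth.
  apply/seteqP; split=> t; first by move=> h; elim/big_ind: _ => //= i _; exact: h.
  by rewrite -bigcap_seq => h i; apply: h; rewrite /= mem_index_enum.
congr (_ _); apply/seteqP; split=> -[x t] /=.
  by move=> h; split=> [|i]; [exact: (h ord0)|have := h (lift ord0 i); rewrite tnthS].
move=> [Bx Bt] i; case: (unliftP ord0 i) => [j ->|->//].
by rewrite tnthS; exact: Bt.
Qed.

End LebesgueTuple.

Section PhaseRetrieval.
Context {R : realType}.

Definition quad_meas N d (A : 'I_N -> 'M[R]_d) (x : 'cV[R]_d) : 'rV[R]_N :=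
  \row_j (x^T *m A j *m x) 0 0.

Definition cV_of_tuple d (t : d.-tuple (measurableTypeR R)) : 'cV[R]_d :=
  \col_i tnth t i.

Definition ae_phase_retrieval N d (A : 'I_N -> 'M[R]_d) : Prop :=
  {ae lebesgue_tuple d, forall t, let x := cV_of_tuple t in
    forall y : 'cV[R]_d, quad_meas A y = quad_meas A x -> y = x \/ y = - x}.

Definition sym_mx d : set 'M[R]_d := [set M | M^T = M].

Definition sym_rank_mx d (r : nat) : set 'M[R]_d :=
  [set M | sym_mx M /\ \rank M = r].

Definition proj_rank_mx d (r : nat) : set 'M[R]_d :=
  [set M | [/\ M = M^T, M = M *m M & \rank M = r]].

(* The upper triangular entries are linear coordinates on the space of
   symmetric d x d matrices; they identify the space of N-tuples of symmetric
   matrices with R^(N * d(d+1)/2), which fixes its Borel sets and its Lebesgue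
   measure. *)
Definition upper_idx d := {ij : 'I_d * 'I_d | (ij.1 <= ij.2)%N}.

Definition sym_coords N d (A : 'I_N -> 'M[R]_d) :
    #|{: 'I_N * upper_idx d}|.-tuple (measurableTypeR R) :=
  [tuple A (enum_val k).1 (val (enum_val k).2).1 (val (enum_val k).2).2
     | k < #|{: 'I_N * upper_idx d}|].

Definition abs_cont_random_sym dT (T : measurableType dT) (P : probability T R)
    N d (A : T -> 'I_N -> 'M[R]_d) : Prop :=
  [/\ forall w j, sym_mx (A w j),
      measurable_fun setT (fun w => sym_coords (A w)) &
      pushforward P (fun w => sym_coords (A w)) `<< lebesgue_tuple _].

End PhaseRetrieval.

(* proj_rank_mx d d is {I}, and several copies of I measure no more than one.
   When d >= 2, two or more V j are {I} and fewer than d are not, every A in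
   the product of the V j fails to have almost everywhere phase retrieval: with
   N' <= d - 1 other matrices, the measurements of unit vectors factor through
   a map from the projective space of dimension d - 1 to R^N', which cannot be
   injective almost everywhere. *)
Definition nonidentity_count {R : realType} N d
    (V : 'I_N -> set 'M[R]_d) : nat :=
  #|[pred j | `[< V j <> [set 1%:M] >]]|.

Arguments sym_rank_mx {R} d r _.
Arguments proj_rank_mx {R} d r _.

Section RealDimension.
Context {R : realType} (n : nat).
Implicit Types S : set ('I_n -> R).

Definition vanishes_on S (p : mpoly.mpoly n R) : Prop :=
  forall x, S x -> mpoly.meval x p = 0.

(* A chain P 0 < ... < P k of prime ideals of the ring R[X_1..X_n] / I(S),
   seen as prime ideals of R[X_1..X_n] containing I(S). *)
Definition prime_chain S (k : nat)
    (P : nat -> prime_idealr (mpoly.mpoly n R)) : Prop :=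
  (forall p, vanishes_on S p -> p \in P 0%N) /\
  forall i, (i < k)%N ->
    {subset P i <= P i.+1} /\ exists2 p, p \in P i.+1 & p \notin P i.

(* Dimension of a semialgebraic set in the sense of Bochnak, Coste and Roy:
   the Krull dimension of its ring of polynomial functions (-oo for set0). *)
Definition real_dim S : \bar R :=
  ereal_sup [set k%:R%:E | k in [set k | exists P, prime_chain S k P]].

Definition zero_locus (F : seq (mpoly.mpoly n R)) : set ('I_n -> R) :=
  [set x | forall p, p \in F -> mpoly.meval x p = 0].

End RealDimension.

Section Generic.
Context {R : realType}.

Definition mx_coords N d (A : 'I_N -> 'M[R]_d) :
    'I_#|{: 'I_N * ('I_d * 'I_d)}| -> R :=
  fun k => A (enum_val k).1 (enum_val k).2.1 (enum_val k).2.2.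

Definition generic_in N d (V Q : set ('I_N -> 'M[R]_d)) : Prop :=
  exists F : seq (mpoly.mpoly #|{: 'I_N * ('I_d * 'I_d)}| R),
    let Z := (@mx_coords N d @` V) `&` zero_locus F in
    (real_dim Z < real_dim (@mx_coords N d @` V))%E /\
    forall A, V A -> ~ Z (mx_coords A) -> Q A.

End Generic.

(* Main.v *)
From HB Require Import structures.
Require Import Defs.
From mathcomp Require Import all_boot all_order all_algebra.
From mathcomp Require Import all_classical all_reals all_analysis.
From mathcomp Require mpoly.
From mathcomp Require Import measurable_realfun ring lra zify.
Import (canonicals, coercions) mpoly.

Set Implicit Arguments.
Unset Strict Implicit.
Unset Printing Implicit Defensive.

Import Order.TTheory GRing.Theory Num.Theory.

Local Open Scope classical_set_scope.
Local Open Scope ring_scope.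

(** The theorem is a dimension count. With u = x + y and v = x - y, the
    vectors x and y have the same measurements under A exactly when u^T A_j v
    = 0 for every j. When u and v are nonzero, this is a nontrivial condition
    on A_j in V_j unless V_j = {I}, and all the models equal to {I} together
    impose the single condition |x| = |y|. There are more than d matrices, and
    unless d = 1 at least d of the models differ from {I}, so these are more
    than d conditions in all. Hence the triples (A, x, y) for which A confuses
    x with some y other than x and -x depend on fewer than dim V + d
    parameters, and the pairs (A, x) that occur in them lie on a proper
    hypersurface: there is a nonzero polynomial q(A, x) that vanishes on all
    of them ([ambiguous_not_dense]). If q does not vanish at (A_0, x_0), take
    F(A) = q(A, x_0). Then F is nonzero on V, and for F(A) <> 0 the polynomial
    q(A, _) is nonzero, so that its zeros form a Lebesgue null set
    ([polyfun_zeros_null]) outside of which A determines x up to sign.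

    Dimensions are compared by counting monomials. Suppose that, on a set T of
    points, the coordinates can be listed so that all but m of them are
    algebraic over the coordinates listed after them. Up to a factor h^D with
    h nowhere zero on T, the polynomials of degree at most D then span a space
    of functions on T of dimension O(D^m), whereas n coordinates have D^n
    monomials of degree less than D in each of them; so n > m coordinates
    satisfy a polynomial relation on T ([trdeg_dependent]). To obtain such a
    list, start with a set whose projection to the (A, x) coordinates is
    Zariski dense. One nontrivial equation that holds on the set makes one new
    coordinate algebraic after restriction to a smaller set that is still
    dense ([dense_equation]), because a dense set that is covered by finitely
    many pieces has a dense piece.

    A rank r symmetric matrix is written as B^T T^-1 B with B of size r x d
    and T symmetric; it is an orthogonal projection when T = B B^T. This
    description is redundant, which is harmless: the superfluous parameters
    are counted both among the coordinates of the triples and among those of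
    the pairs. What matters is that around each point the parameters can be
    recovered as polynomials in the matrix ([chart_section]), so that q
    becomes a polynomial in A.

    For random symmetric matrices, take all ranks equal to d and multiply F by
    the determinants of the matrices: the zeros of the product are negligible
    for an absolutely continuous law. For the other statement, the chart shows
    that V is irreducible, so that the ideal of V is prime. It can be put
    below any chain of primes for the subset F = 0 of V, which lowers the
    Krull dimension provided that chains have bounded length; they do, by the
    same counting of monomials ([prime_chain_le], [real_dim_drop]). When d = 1
    every A in V works, since it contains a nonzero scalar. *)

(** * Polynomial functions *)

(** Polynomial functions are the algebra generated by G, whatever the domain X:
    a space of coordinates, of tuples or of families of matrices. Changing the
    domain is then only a matter of checking generators ([polyfun_comp]). *)
Inductive polyfun (R : numFieldType) (X : Type) (G : set (X -> R)) :
    (X -> R) -> Prop :=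
| polyfun_gen g of G g : polyfun G g
| polyfun_cst c : polyfun G (fun=> c)
| polyfun_add f g of polyfun G f & polyfun G g : polyfun G (fun x => f x + g x)
| polyfun_mul f g of polyfun G f & polyfun G g : polyfun G (fun x => f x * g x).

Definition polymx (R : numFieldType) (X : Type) (G : set (X -> R)) m n
    (M : X -> 'M[R]_(m, n)) :=
  forall i j, polyfun G (fun x => M x i j).

Section PolyFun.
Context {R : numFieldType} {X : Type}.
Implicit Types (G : set (X -> R)) (f g : X -> R).

Lemma polyfun_eq G f g : polyfun G f -> f =1 g -> polyfun G g.
Proof. by move=> Gf /funext <-. Qed.

Lemma polyfun_opp G f : polyfun G f -> polyfun G (fun x => - f x).
Proof.
move=> Gf; apply: (@polyfun_eq _ (fun x => -1 * f x)) => [|x].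
  exact: polyfun_mul (polyfun_cst _ _) Gf.
by rewrite mulN1r.
Qed.

Lemma polyfun_sub G f g :
  polyfun G f -> polyfun G g -> polyfun G (fun x => f x - g x).
Proof. by move=> Gf /polyfun_opp; exact: polyfun_add. Qed.

Lemma polyfun_sum G (I : Type) (r : seq I) (P : pred I) (F : I -> X -> R) :
  (forall i, polyfun G (F i)) -> polyfun G (fun x => \sum_(i <- r | P i) F i x).
Proof.
move=> GF; elim: r => [|i r IH].
  by apply: polyfun_eq (polyfun_cst _ 0) _ => x; rewrite big_nil.
case: (boolP (P i)) => Pi; last first.
  by apply: polyfun_eq IH _ => x; rewrite big_cons (negbTE Pi).
by apply: polyfun_eq (polyfun_add (GF i) IH) _ => x; rewrite big_cons Pi.
Qed.

Lemma polyfun_prod G (I : Type) (r : seq I) (P : pred I) (F : I -> X -> R) :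
  (forall i, polyfun G (F i)) -> polyfun G (fun x => \prod_(i <- r | P i) F i x).
Proof.
move=> GF; elim: r => [|i r IH].
  by apply: polyfun_eq (polyfun_cst _ 1) _ => x; rewrite big_nil.
case: (boolP (P i)) => Pi; last first.
  by apply: polyfun_eq IH _ => x; rewrite big_cons (negbTE Pi).
by apply: polyfun_eq (polyfun_mul (GF i) IH) _ => x; rewrite big_cons Pi.
Qed.

Lemma polyfun_exp G f n : polyfun G f -> polyfun G (fun x => f x ^+ n).
Proof.
move=> Gf; elim: n => [|n IH].
  by apply: polyfun_eq (polyfun_cst _ 1) _ => x; rewrite expr0.
by apply: polyfun_eq (polyfun_mul Gf IH) _ => x; rewrite exprS.
Qed.

Lemma polyfun_comp (Y : Type) G (G' : set (Y -> R)) (h : Y -> X) f :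
  (forall g, G g -> polyfun G' (g \o h)) -> polyfun G f -> polyfun G' (f \o h).
Proof.
move=> Gh; elim=> [g /Gh//|c|a b _ Ga _ Gb|a b _ Ga _ Gb].
- exact: polyfun_cst.
- exact: polyfun_add.
- exact: polyfun_mul.
Qed.

Lemma polyfunW G G' f : G `<=` G' -> polyfun G f -> polyfun G' f.
Proof.
move=> GG'; apply: (@polyfun_comp _ G G' id) => g /GG'; exact: polyfun_gen.
Qed.

(** Restriction to a curve with polynomial coordinates reduces questions about
    zeros to one variable. *)
Lemma polyfun_along G (h : R -> X) f :
  (forall g, G g -> exists p : {poly R}, forall t, g (h t) = p.[t]) ->
  polyfun G f -> exists p : {poly R}, forall t, f (h t) = p.[t].
Proof.
move=> Gh; elim=> [g /Gh//|c|a b _ [p Hp] _ [q Hq]|a b _ [p Hp] _ [q Hq]].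
- by exists c%:P => t; rewrite hornerC.
- by exists (p + q) => t; rewrite hornerD Hp Hq.
- by exists (p * q) => t; rewrite hornerM Hp Hq.
Qed.

Section Matrices.
Variable G : set (X -> R).

Lemma polymx_cst m n (A : 'M[R]_(m, n)) : polymx G (fun=> A).
Proof. by move=> i j; exact: polyfun_cst. Qed.

Lemma polymx_add m n (A B : X -> 'M[R]_(m, n)) :
  polymx G A -> polymx G B -> polymx G (fun x => A x + B x).
Proof.
by move=> GA GB i j; apply: polyfun_eq (polyfun_add (GA i j) (GB i j)) _ => x;
  rewrite mxE.
Qed.

Lemma polymx_opp m n (A : X -> 'M[R]_(m, n)) :
  polymx G A -> polymx G (fun x => - A x).
Proof. by move=> GA i j; apply: polyfun_eq (polyfun_opp (GA i j)) _ => x;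
  rewrite mxE. Qed.

Lemma polymx_sub m n (A B : X -> 'M[R]_(m, n)) :
  polymx G A -> polymx G B -> polymx G (fun x => A x - B x).
Proof. by move=> GA /polymx_opp; exact: polymx_add. Qed.

Lemma polymx_scale m n c (A : X -> 'M[R]_(m, n)) :
  polymx G A -> polymx G (fun x => c *: A x).
Proof.
by move=> GA i j; apply: polyfun_eq (polyfun_mul (polyfun_cst _ c) (GA i j)) _ =>
  x; rewrite mxE.
Qed.

Lemma polymx_mul m n p (A : X -> 'M[R]_(m, n)) (B : X -> 'M[R]_(n, p)) :
  polymx G A -> polymx G B -> polymx G (fun x => A x *m B x).
Proof.
move=> GA GB i j.
have := @polyfun_sum G _ (index_enum _) predT (fun k x => A x i k * B x k j)
  (fun k => polyfun_mul (GA i k) (GB k j)).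
by move/polyfun_eq; apply => x; rewrite mxE.
Qed.

Lemma polymx_tr m n (A : X -> 'M[R]_(m, n)) :
  polymx G A -> polymx G (fun x => (A x)^T).
Proof. by move=> GA i j; apply: polyfun_eq (GA j i) _ => x; rewrite mxE. Qed.

Lemma polyfun_det n (A : X -> 'M[R]_n) :
  polymx G A -> polyfun G (fun x => \det (A x)).
Proof.
move=> GA; rewrite /determinant; apply: polyfun_sum => s.
apply: polyfun_mul; first exact: polyfun_cst.
by apply: polyfun_prod => i; exact: GA.
Qed.

Lemma polymx_adj n (A : X -> 'M[R]_n) :
  polymx G A -> polymx G (fun x => \adj (A x)).
Proof.
move=> GA i j.
apply: (@polyfun_eq _ (fun x => cofactor (A x) j i)); last by move=> x; rewrite mxE.
rewrite /cofactor; apply: polyfun_mul; first exact: polyfun_cst.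
apply: polyfun_det => k l.
by apply: polyfun_eq (GA _ _) _ => x; rewrite !mxE.
Qed.

End Matrices.
End PolyFun.

Definition polyon (R : numFieldType) (K : eqType) (l : seq K) :
    ((K -> R) -> R) -> Prop :=
  polyfun [set (fun w => w k) | k in [set k | k \in l]].

Section PolyOn.
Context {R : numFieldType} {K : eqType}.
Implicit Types (l s : seq K) (f g : (K -> R) -> R) (w v : K -> R).

Lemma polyon_var l k : k \in l -> polyon l (fun w : K -> R => w k).
Proof. by move=> kl; apply: polyfun_gen; exists k. Qed.

Lemma polyonW l s f : {subset l <= s} -> polyon l f -> polyon s f.
Proof. by move=> ls; apply: polyfunW => _ [k /ls ks <-]; exists k. Qed.

Lemma polyon_local l f w v :
  polyon l f -> {in l, w =1 v} -> f w = f v.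
Proof.
move=> + wv; elim=> [_ [k kl <-]|//|a b _ -> _ -> //|a b _ -> _ -> //].
exact: wv.
Qed.

Lemma polyon_line l f w v : polyon l f ->
  exists p : {poly R}, forall t, f (fun k => w k + t * (v k - w k)) = p.[t].
Proof.
apply: (@polyfun_along _ _ _ (fun t k => w k + t * (v k - w k))) => _ [k _ <-].
exists ((w k)%:P + 'X * (v k - w k)%:P) => t.
by rewrite !(hornerD, hornerC, hornerM, hornerX).
Qed.

Lemma poly_nonroot (p : {poly R}) : p != 0 -> exists t, p.[t] != 0.
Proof.
move=> p0; apply: contrapT => /forallNP H.
have Hall : all (root p) [seq i%:R | i <- iota 0 (size p)].
  by apply/allP => x _; apply/rootP/eqP; rewrite -[_ == _]negbK; apply/negP; exact: H.
have Huniq : uniq [seq i%:R : R | i <- iota 0 (size p)].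
  by rewrite map_inj_uniq ?iota_uniq // => i j /eqP; rewrite eqr_nat => /eqP.
by have := max_poly_roots p0 Hall Huniq; rewrite size_map size_iota ltnn.
Qed.

(** Nonzero polynomial functions form a domain: join a point where f is nonzero
    to one where g is, and use that a nonzero polynomial in one variable has
    finitely many roots. *)
Lemma polyon_nonzero_mul l f g w v : polyon l f -> polyon l g ->
  f w != 0 -> g v != 0 -> exists u, f u * g u != 0.
Proof.
move=> /(polyon_line w v)[p Hp] /(polyon_line w v)[q Hq] fw gv.
have p0 : p != 0.
  apply: contraNneq fw => p0; have := Hp 0; rewrite p0 horner0 => <-.
  by apply/eqP; congr f; apply/funext => k; rewrite mul0r addr0.
have q0 : q != 0.
  apply: contraNneq gv => q0; have := Hq 1; rewrite q0 horner0 => <-.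
  by apply/eqP; congr g; apply/funext => k; rewrite mul1r addrC subrK.
have [t] : exists t, (p * q).[t] != 0 by apply: poly_nonroot; rewrite mulf_neq0.
by rewrite hornerM -Hp -Hq; exists (fun k => w k + t * (v k - w k)).
Qed.

Lemma polyon_nonzero_prod l (I : Type) (r : seq I) (F : I -> (K -> R) -> R) :
  (forall i, polyon l (F i)) -> (forall i, exists w, F i w != 0) ->
  exists w, \prod_(i <- r) F i w != 0.
Proof.
move=> lF F0; elim: r => [|i r [v vr]].
  by exists (fun=> 0); rewrite big_nil oner_eq0.
have [w wi] := F0 i.
have lr : polyon l (fun w => \prod_(i <- r) F i w) by exact: polyfun_prod.
have [u uP] := polyon_nonzero_mul (lF i) lr wi vr.
by exists u; rewrite big_cons.
Qed.

End PolyOn.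

(** * Degrees on a list of coordinates *)

(** The degree is bounded in each coordinate separately. With this choice the
    first coordinate of the list can be split off without any loss. *)
Fixpoint boxdeg (R : numFieldType) (K : eqType) (l : seq K) (D : nat)
    (f : (K -> R) -> R) : Prop :=
  if l is k :: l' then
    exists2 a : nat -> (K -> R) -> R, (forall i, boxdeg l' D (a i)) &
      forall w, f w = \sum_(i < D.+1) a i w * w k ^+ i
  else exists c, forall w, f w = c.

Section BoxDeg.
Context {R : numFieldType} {K : eqType}.
Implicit Types (l s : seq K) (f g : (K -> R) -> R) (w v : K -> R).

Lemma boxdeg_eq l D f g : boxdeg l D f -> f =1 g -> boxdeg l D g.
Proof. by move=> lf /funext <-. Qed.

Lemma boxdeg_cst l D c : boxdeg l D (fun=> c : R).
Proof.
elim: l c => [|k l IH] c /=; first by exists c.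
exists (fun i w => if i == 0%N then c else 0) => [[|i]//|w]; try exact: IH.
rewrite big_ord_recl /= mulr1 big1 ?addr0 // => i _.
by rewrite mul0r.
Qed.

Lemma boxdeg_add l D f g :
  boxdeg l D f -> boxdeg l D g -> boxdeg l D (fun w => f w + g w).
Proof.
elim: l f g => [|k l IH] f g /=.
  by move=> [c fc] [e ge]; exists (c + e) => w; rewrite fc ge.
move=> [a la fa] [b lb gb]; exists (fun i w => a i w + b i w) => [i|w];
  first exact: IH.
by rewrite fa gb -big_split; apply: eq_bigr => i _; rewrite mulrDl.
Qed.

Lemma boxdeg_sum l D (I : Type) (r : seq I) (F : I -> (K -> R) -> R) :
  (forall i, boxdeg l D (F i)) -> boxdeg l D (fun w => \sum_(i <- r) F i w).
Proof.
move=> lF; elim: r => [|i r IH].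
  by apply: boxdeg_eq (boxdeg_cst _ _ 0) _ => w; rewrite big_nil.
by apply: boxdeg_eq (boxdeg_add (lF i) IH) _ => w; rewrite big_cons.
Qed.

Lemma boxdegW l D D' f : (D <= D')%N -> boxdeg l D f -> boxdeg l D' f.
Proof.
move=> DD'; elim: l f => [//|k l IH] f /= [a la fa].
exists (fun i w => if (i < D.+1)%N then a i w else 0) => [i|w].
  by case: (i < D.+1)%N; [exact: IH | exact: boxdeg_cst].
rewrite fa (big_ord_widen D'.+1 (fun i => a i w * w k ^+ i)) // big_mkcond /=.
by apply: eq_bigr => i _; case: ifP; rewrite ?mul0r.
Qed.

Lemma boxdeg_mul l D D' f g :
  boxdeg l D f -> boxdeg l D' g -> boxdeg l (D + D') (fun w => f w * g w).
Proof.
elim: l f g => [|k l IH] f g /=.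
  by move=> [c fc] [e ge]; exists (c * e) => w; rewrite fc ge.
move=> [a la fa] [b lb gb].
exists (fun n w => \sum_(i < D.+1) \sum_(j < D'.+1)
                     if (i + j == n)%N then a i w * b j w else 0) => [n|w].
  apply: boxdeg_sum => i; apply: boxdeg_sum => j.
  by case: (i + j == n)%N; [exact: IH | exact: boxdeg_cst].
rewrite fa gb mulr_suml; under [RHS]eq_bigr do rewrite mulr_suml.
rewrite exchange_big /=; apply: eq_bigr => i _.
rewrite mulr_sumr; under [RHS]eq_bigr do rewrite mulr_suml.
rewrite exchange_big /=; apply: eq_bigr => j _.
have ijD : (i + j < (D + D').+1)%N by have := ltn_ord i; have := ltn_ord j; lia.
rewrite (bigD1 (Ordinal ijD)) //= eqxx big1 ?addr0.
  by rewrite exprD; ring.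
move=> n nij; case: eqP => [E|]; last by rewrite mul0r.
by case/negP: nij; apply/eqP/val_inj.
Qed.

Lemma boxdeg_exp l D f n : boxdeg l D f -> boxdeg l (n * D) (fun w => f w ^+ n).
Proof.
move=> lf; elim: n => [|n IH].
  by apply: boxdeg_eq (boxdeg_cst _ _ 1) _ => w; rewrite expr0.
by rewrite mulSn; apply: boxdeg_eq (boxdeg_mul lf IH) _ => w; rewrite exprS.
Qed.

Lemma boxdeg_cons l D k f : boxdeg l D f -> boxdeg (k :: l) D f.
Proof.
move=> lf; exists (fun i w => if i == 0%N then f w else 0) => [[|i]//|w].
  exact: boxdeg_cst.
rewrite big_ord_recl /= mulr1 big1 ?addr0 // => i _.
by rewrite mul0r.
Qed.

Lemma boxdeg_var l k : k \in l -> boxdeg l 1 (fun w => w k).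
Proof.
elim: l => [//|k' l IH]; rewrite inE => /predU1P[<-|/IH /(boxdeg_cons k')//].
exists (fun i w => if i == 1%N then 1 else 0) => [[|[|i]]|w]; try exact: boxdeg_cst.
by rewrite !big_ord_recl big_ord0 /=; ring.
Qed.

Lemma polyon_boxdeg l f : polyon l f -> exists D, boxdeg l D f.
Proof.
elim=> [_ [k kl <-]|c|a b _ [D aD] _ [D' bD]|a b _ [D aD] _ [D' bD]].
- by exists 1%N; exact: boxdeg_var.
- by exists 0%N; exact: boxdeg_cst.
- exists (maxn D D'); apply: boxdeg_add.
    exact: boxdegW (leq_maxl _ _) aD.
  exact: boxdegW (leq_maxr _ _) bD.
- by exists (D + D')%N; exact: boxdeg_mul.
Qed.

Lemma boxdeg_polyon l D f : boxdeg l D f -> polyon l f.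
Proof.
elim: l f => [|k l IH] f /=.
  by move=> [c fc]; apply: polyfun_eq (polyfun_cst _ c) _ => w; rewrite fc.
move=> [a la fa].
apply: (@polyfun_eq _ _ _ (fun w => \sum_(i < D.+1) a i w * w k ^+ i)); last first.
  by move=> w; rewrite fa.
apply: polyfun_sum => i; apply: polyfun_mul.
  by apply: (polyonW _ (IH _ (la i))) => j; rewrite inE orbC => ->.
by apply: polyfun_exp; apply: polyon_var; rewrite mem_head.
Qed.

Lemma polyon_cons l k f : polyon (k :: l) f ->
  exists D (a : nat -> (K -> R) -> R), (forall i, polyon l (a i)) /\
    forall w, f w = \sum_(i < D.+1) a i w * w k ^+ i.
Proof.
by move=> /polyon_boxdeg[D [a la fa]]; exists D, a; split=> // i;
  exact: boxdeg_polyon (la i).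
Qed.

End BoxDeg.

(** * Counting functions on a set of bounded transcendence degree *)

(** A relation of positive degree e.+1 whose leading coefficient vanishes
    nowhere on T, so that dividing by it is possible at every point. *)
Definition algebraic_on (R : numFieldType) (K : eqType) (T : set (K -> R))
    (l : seq K) (k : K) : Prop :=
  exists e (a : nat -> (K -> R) -> R),
    [/\ forall i, polyon l (a i), forall w, T w -> a e.+1 w != 0 &
        forall w, T w -> \sum_(i < e.+2) a i w * w k ^+ i = 0].

(** A pointwise form of a transcendence degree at most m: the coordinates of the
    list are adjoined from the right, and all but m of them are algebraic over
    those already adjoined. *)
Inductive trdeg_le (R : numFieldType) (K : eqType) (T : set (K -> R)) :
    seq K -> nat -> Prop :=
| trdeg_nil : trdeg_le T [::] 0
| trdeg_free k l m of trdeg_le T l m : trdeg_le T (k :: l) m.+1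
| trdeg_alg k l m of trdeg_le T l m & algebraic_on T l k : trdeg_le T (k :: l) m.

Section Growth.
Context {R : numFieldType} {K : eqType}.
Implicit Types (T : set (K -> R)) (l s : seq K) (f g h : (K -> R) -> R).

Lemma trdeg_leW T T' l m : T' `<=` T -> trdeg_le T l m -> trdeg_le T' l m.
Proof.
move=> T'T; elim=> [|k {}l {}m _ IH|k {}l {}m _ IH [e [a [la a0 aT]]]].
- exact: trdeg_nil.
- exact: trdeg_free.
- apply: trdeg_alg IH _; exists e, a; split=> // w /T'T; [exact: a0|exact: aT].
Qed.

Definition spanned_by T (B : finType) (b : B -> (K -> R) -> R) f :=
  exists u : B -> R, forall w, T w -> f w = \sum_(i : B) u i * b i w.

(** The factor h^D clears the leading coefficients of the algebraic relations;
    as h has no zero on T, it does not affect linear relations there. *)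
Definition growth_le T l m :=
  exists2 h, (forall w, T w -> h w != 0) &
  exists c, forall D, exists (B : finType) (b : B -> (K -> R) -> R),
    (#|B| <= c * D.+1 ^ m)%N /\
    forall f, boxdeg l D f -> spanned_by T b (fun w => h w ^+ D * f w).

Lemma spanned_by_pair T (I B : finType) (z : I -> (K -> R) -> R)
    (b : B -> (K -> R) -> R) (F : I -> (K -> R) -> R) :
  (forall i, spanned_by T b (F i)) ->
  spanned_by T (fun ib : I * B => fun w => z ib.1 w * b ib.2 w)
    (fun w => \sum_(i : I) F i w * z i w).
Proof.
move=> /choice[u uF]; exists (fun ib => u ib.1 ib.2) => w Tw.
under eq_bigr => i _ do rewrite uF // mulr_suml.
by rewrite pair_bigA /=; apply: eq_bigr => -[i j] _ /=; ring.
Qed.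

Lemma leq_expr2 m p n : (m <= p)%N -> (m ^ n <= p ^ n)%N.
Proof. by move=> mp; elim: n => // n IH; rewrite !expnS leq_mul. Qed.

Lemma growth_nil T : growth_le T [::] 0.
Proof.
exists (fun=> 1) => [w _|]; first exact: oner_neq0.
exists 1%N => D; exists unit, (fun _ _ => 1); split; first by rewrite card_unit.
move=> f [c fc]; exists (fun=> c) => w _.
by rewrite fc expr1n mul1r big_const card_unit /= mulr1 addr0.
Qed.

Lemma growth_free T l m k : growth_le T l m -> growth_le T (k :: l) m.+1.
Proof.
move=> [h h0 [c hc]]; exists h => //; exists c => D.
have [B [b [cB bP]]] := hc D.
exists ('I_D.+1 * B)%type, (fun (ib : 'I_D.+1 * B) w => w k ^+ ib.1 * b ib.2 w);
  split.
  by rewrite card_prod card_ord expnS mulnCA leq_mul2l cB orbT.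
move=> f [a la fa].
have [u uP] := @spanned_by_pair T 'I_D.+1 B (fun i w => w k ^+ i) b
  (fun i w => h w ^+ D * a i w) (fun i => bP _ (la i)).
exists u => w Tw; rewrite -uP // fa mulr_sumr.
by apply: eq_bigr => i _; rewrite mulrA.
Qed.

(** With a the leading coefficient, the relation rewrites a w_k^(e+1) in lower
    powers of w_k, so every power of a w_k reduces to powers at most e of w_k,
    each reduction step raising the degree of the coefficients by s. *)
Lemma algebraic_power T l k (s e : nat) (a : nat -> (K -> R) -> R) :
  (forall i, (i < e.+2)%N -> boxdeg l s (a i)) ->
  (forall w, T w -> \sum_(i < e.+2) a i w * w k ^+ i = 0) ->
  forall n, exists2 g : nat -> (K -> R) -> R, (forall j, boxdeg l (n * s) (g j)) &
    forall w, T w ->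
      (a e.+1 w * w k) ^+ n = \sum_(j < e.+1) g j w * w k ^+ j.
Proof.
move=> la aT; elim=> [|n [g lg gP]].
  exists (fun j w => if j == 0%N then 1 else 0) => [[|j]|w _]; try exact: boxdeg_cst.
  by rewrite big_ord_recl /= big1 ?addr0 ?mulr1 // => i _; rewrite mul0r.
exists (fun j w => (if j is j'.+1 then g j' w * a e.+1 w else 0) -
          (if (j < e.+1)%N then g e w * a j w else 0)) => [j|w Tw].
  apply: (@boxdeg_eq _ _ _ _ (fun w => (if j is j'.+1 then g j' w * a e.+1 w else 0) +
      -1 * (if (j < e.+1)%N then g e w * a j w else 0))); last first.
    by move=> w; rewrite mulN1r.
  rewrite mulSn addnC; apply: boxdeg_add.
    by case: j => [|j]; [exact: boxdeg_cst | apply: boxdeg_mul => //; exact: la].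
  rewrite -[X in boxdeg _ X]add0n; apply: boxdeg_mul; first exact: boxdeg_cst.
  case: (boolP (j < e.+1)%N) => je; last exact: boxdeg_cst.
  by apply: boxdeg_mul => //; apply: la; lia.
have rel : a e.+1 w * w k ^+ e.+1 = - \sum_(j < e.+1) a j w * w k ^+ j.
  by apply/eqP; rewrite -addr_eq0 addrC; have := aT w Tw;
    rewrite big_ord_recr /= => ->.
rewrite exprSr gP // mulr_suml.
under [RHS]eq_bigr => j _ do rewrite ltn_ord mulrBl.
rewrite sumrB big_ord_recr /= [X in _ = X - _]big_ord_recl /= mul0r add0r.
congr (_ + _).
  by apply: eq_bigr => i _; rewrite /bump /= add1n exprS; ring.
transitivity (g e w * (a e.+1 w * w k ^+ e.+1)); first by rewrite exprS; ring.
rewrite rel mulrN mulr_sumr; congr (- _).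
by apply: eq_bigr => i _; rewrite mulrA.
Qed.

(** Powers of an algebraic coordinate are bounded after reduction, so adjoining
    it multiplies the dimension by a constant and D by a constant; the exponent
    m stays the same. *)
Lemma growth_alg T l m k :
  growth_le T l m -> algebraic_on T l k -> growth_le T (k :: l) m.
Proof.
move=> [h h0 [c hc]] [e [a [la a0 aT]]].
have [s sP] : exists s : nat, forall i, (i < e.+2)%N -> boxdeg l s (a i).
  have /choice[d dP] : forall i, exists D, boxdeg l D (a i).
    by move=> i; exact: polyon_boxdeg.
  exists (\sum_(i < e.+2) d i)%N => i ie.
  by apply: boxdegW (dP i); rewrite (bigD1 (Ordinal ie)) //= leq_addr.
have /choice[g gP] := fun n => (exists2P _ _).1 (algebraic_power sP aT n).
exists (fun w => h w ^+ s.+1 * a e.+1 w) => [w Tw|].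
  by rewrite mulf_neq0 // ?expf_neq0 ?h0 ?a0.
exists (e.+1 * (c * s.+1 ^ m))%N => D.
have [B [b [cB bP]]] := hc (s.+1 * D)%N.
exists ('I_e.+1 * B)%type, (fun (ib : 'I_e.+1 * B) w => w k ^+ ib.1 * b ib.2 w);
  split.
  rewrite card_prod card_ord -!mulnA leq_mul2l /= (leq_trans cB) //.
  by rewrite leq_mul2l -expnMn leq_expr2 ?orbT //; lia.
move=> f [F lF fF].
pose G j w := \sum_(i < D.+1) F i w * (a e.+1 w ^+ (D - i) * g i j w).
have lG j : boxdeg l (s.+1 * D) (G j).
  apply: boxdeg_sum => i; have [gi _] := gP i.
  have iD := ltn_ord i.
  have -> : (s.+1 * D = D + ((D - i) * s + i * s))%N by nia.
  apply: (boxdeg_mul (lF i)); apply: boxdeg_mul; last exact: gi.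
  by apply: boxdeg_exp; exact: sP.
have [u uP] := @spanned_by_pair T 'I_e.+1 B (fun i w => w k ^+ i) b
  (fun j w => h w ^+ (s.+1 * D) * G j w) (fun j => bP _ (lG j)).
exists u => w Tw; rewrite -uP //.
under eq_bigr => j _ do rewrite -mulrA.
rewrite -mulr_sumr exprMn -exprM -mulrA; congr (_ * _).
under eq_bigr => j _ do rewrite mulr_suml.
rewrite exchange_big /= fF mulr_sumr; apply: eq_bigr => i _.
have [_ gi] := gP i.
transitivity (F i w * a e.+1 w ^+ (D - i) * (a e.+1 w * w k) ^+ i).
  have iD : (i <= D)%N by rewrite -ltnS.
  by rewrite -{1}(subnK iD) exprD exprMn; ring.
rewrite gi // mulr_sumr; apply: eq_bigr => j _; ring.
Qed.

Lemma trdeg_growth T l m : trdeg_le T l m -> growth_le T l m.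
Proof.
elim=> [|k {}l {}m _|k {}l {}m _].
- exact: growth_nil.
- exact: growth_free.
- exact: growth_alg.
Qed.

End Growth.

(** * Algebraic dependence of many coordinates *)

Lemma linear_dependency (F : fieldType) n m (u : 'M[F]_(n, m)) : (m < n)%N ->
  exists2 c : 'rV_n, c != 0 & c *m u = 0.
Proof.
move=> mn; exists (nz_row (kermx u)).
  rewrite nz_row_eq0 -mxrank_eq0 mxrank_ker -lt0n subn_gt0.
  exact: leq_ltn_trans (rank_leq_col u) mn.
by apply/sub_kermxP; exact: nz_row_sub.
Qed.

(** The digits of i in base D are the exponents. A polynomial of degree less than
    D in each of k variables is thus a family indexed by the numbers i < D ^ k. *)
Fixpoint digit_monomial (A : comNzRingType) (D : nat) (fs : seq A) (i : nat) : A :=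
  if fs is f :: fs' then
    f ^+ (i %/ D ^ size fs') * digit_monomial D fs' (i %% D ^ size fs')
  else 1.

Section Dependence.
Context {R : numFieldType} {K : eqType}.
Implicit Types (T : set (K -> R)) (J l s : seq K) (f g q : (K -> R) -> R).

Lemma polyon_digit_monomial D J i :
  polyon J (fun w => digit_monomial D [seq w k | k <- J] i : R).
Proof.
elim: J i => [|k J IH] i /=; first exact: polyfun_cst.
apply: polyfun_mul.
  apply: (@polyfun_eq _ _ _ (fun w => w k ^+ (i %/ D ^ size J))) => [|w]; last first.
    by rewrite size_map.
  by apply: polyfun_exp; apply: polyon_var; rewrite mem_head.
apply: (@polyonW _ _ J) => [j|]; first by rewrite inE orbC => ->.
by apply: polyfun_eq (IH (i %% D ^ size J)%N) _ => w; rewrite size_map.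
Qed.

Lemma boxdeg_digit_monomial D J l i : {subset J <= l} -> (i < D ^ size J)%N ->
  boxdeg l (size J * D) (fun w => digit_monomial D [seq w k | k <- J] i : R).
Proof.
elim: J i => [|k J IH] i Jl /=; first by move=> _; exact: boxdeg_cst.
rewrite expnS mulSn => iD.
have D0 : (0 < D ^ size J)%N by move: iD; case: (D ^ size J)%N; rewrite ?muln0.
apply: boxdeg_mul.
  apply: (@boxdegW _ _ _ ((i %/ D ^ size J) * 1)); last first.
    apply: (@boxdeg_eq _ _ _ _ (fun w => w k ^+ (i %/ D ^ size J))) => [|w];
      last first.
      by rewrite size_map.
    by apply: boxdeg_exp; apply: boxdeg_var; apply: Jl; rewrite mem_head.
  by rewrite muln1 ltnW // ltn_divLR.
apply: (@boxdeg_eq _ _ _ _ (fun w =>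
  digit_monomial D [seq w k | k <- J] (i %% D ^ size J))) => [|w].
  by apply: IH; [move=> j jJ; apply: Jl; rewrite inE jJ orbT|rewrite ltn_mod].
by rewrite size_map.
Qed.

(** Kronecker substitution: at w_k = t^(D^position) the monomial of index i takes
    the value t^i, so distinct monomials stay distinct in one variable. *)
Lemma digit_monomial_kronecker D J : uniq J ->
  forall t : R, exists w : K -> R,
    forall i, (i < D ^ size J)%N -> digit_monomial D [seq w k | k <- J] i = t ^+ i.
Proof.
elim: J => [|k J IH] /=; first by move=> _ t; exists (fun=> 0) => -[].
move=> /andP[kJ /IH{}IH] t; have [w wP] := IH t.
exists (fun j => if j == k then t ^+ (D ^ size J) else w j) => i iD.
have D0 : (0 < D ^ size J)%N.
  by move: iD; rewrite expnS; case: (D ^ size J)%N; rewrite ?muln0.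
rewrite eqxx size_map.
have -> : [seq (if j == k then t ^+ (D ^ size J) else w j) | j <- J] =
    [seq w j | j <- J].
  by apply/eq_in_map => j jJ; case: eqP => // jk; rewrite -jk jJ in kJ.
rewrite wP ?ltn_mod // -exprM -exprD; congr (_ ^+ _).
by rewrite mulnC -divn_eq.
Qed.

(** The D^n monomials in the coordinates J, with n > m, lie in a space of
    dimension at most a constant times D^m, hence are linearly dependent on T
    for D large. The relation is a nonzero polynomial by Kronecker substitution. *)
Lemma trdeg_dependent T l m J :
  trdeg_le T l m -> {subset J <= l} -> uniq J -> (m < size J)%N ->
  exists q, [/\ polyon J q, (exists w, q w != 0) & forall w, T w -> q w = 0].
Proof.
move=> /trdeg_growth[h h0 [c hc]] Jl uJ mJ.
(* D exceeds the constant c (n + 1)^m of the bound for degrees up to n D. *)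
pose n := size J; pose D := (c * n.+1 ^ m).+1.
have [B [b [cB bP]]] := hc (n * D)%N.
have BD : (#|B| < D ^ n)%N.
  apply: (leq_ltn_trans cB).
  apply: (@leq_ltn_trans (c * (n.+1 * D) ^ m)).
    by rewrite leq_mul2l leq_expr2 ?orbT // mulSn -add1n leq_add2r.
  apply: (@leq_trans (D ^ m.+1)); last by rewrite leq_pexp2l.
  by rewrite expnMn mulnA expnS ltn_pmul2r // expn_gt0.
have /choice[u uP] : forall i : 'I_(D ^ n), spanned_by T b
    (fun w => h w ^+ (n * D) * digit_monomial D [seq w k | k <- J] i).
  by move=> i; apply: bP; exact: boxdeg_digit_monomial.
have [e e0 eu] := linear_dependency (\matrix_(i, j) u i (enum_val j)) BD.
exists (fun w => \sum_(i < D ^ n) e 0 i * digit_monomial D [seq w k | k <- J] i).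
split.
- apply: polyfun_sum => i; apply: polyfun_mul; first exact: polyfun_cst.
  exact: polyon_digit_monomial.
- have p0 : rVpoly e != 0.
    by apply: contraNneq e0 => p0; rewrite -(rVpolyK e) p0 linear0.
  have [t pt] := poly_nonroot p0.
  have [w wP] := digit_monomial_kronecker D uJ t.
  exists w; apply: contraNneq pt => q0.
  rewrite -q0 /rVpoly horner_poly; apply/eqP; apply: eq_bigr => i _.
  by rewrite wP // valK.
- move=> w Tw; apply: (mulfI (expf_neq0 (n * D) (h0 _ Tw))); rewrite mulr0 mulr_sumr.
  under eq_bigr => i _ do rewrite mulrCA uP // mulr_sumr.
  rewrite exchange_big /= big1 // => j _.
  have /rowP/(_ (enum_rank j)) := eu; rewrite !mxE => euj.
  under eq_bigr do rewrite mulrA.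
  rewrite -mulr_suml; move: euj.
  by under eq_bigr do rewrite mxE enum_rankK; move=> ->; rewrite mul0r.
Qed.

End Dependence.

(** * Zariski dense projections *)

(** The projection of T to the coordinates J is Zariski dense. *)
Definition dense_on (R : numFieldType) (K : eqType) (J : seq K)
    (T : set (K -> R)) : Prop :=
  forall q, polyon J q -> (forall w, T w -> q w = 0) -> forall w, q w = 0.

Section Density.
Context {R : numFieldType} {K : eqType}.
Variable J : seq K.
Implicit Types (T : set (K -> R)) (l s : seq K) (f g q : (K -> R) -> R).

Lemma dense_nonempty T : dense_on J T -> exists w, T w.
Proof.
move=> dT; apply: contrapT => /forallNP T0.
have := dT _ (polyfun_cst _ 1) (fun w Tw => False_ind _ (T0 w Tw)) (fun=> 0).
by move/eqP; rewrite oner_eq0.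
Qed.

(** If both pieces satisfied a nonzero equation, then so would T, by the product
    of the two equations. *)
Lemma dense_split T (P : set (K -> R)) : dense_on J T ->
  dense_on J (T `&` P) \/ dense_on J (T `&` ~` P).
Proof.
move=> dT; apply: contrapT => /not_orP[].
move=> /existsNP[f /not_implyP[Jf /not_implyP[fP /existsNP[w /eqP fw]]]].
move=> /existsNP[g /not_implyP[Jg /not_implyP[gP /existsNP[v /eqP gv]]]].
have [u /eqP] := polyon_nonzero_mul Jf Jg fw gv; apply.
apply: (dT _ (polyfun_mul Jf Jg)) => z Tz.
have [Pz|nPz] := pselect (P z); first by rewrite fP ?mul0r.
by rewrite gP ?mulr0.
Qed.

Lemma dense_cover T n (P : nat -> set (K -> R)) : dense_on J T ->
  (forall w, T w -> exists2 i, (i < n)%N & P i w) ->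
  exists2 i, (i < n)%N & dense_on J (T `&` P i).
Proof.
elim: n T => [|n IH] T dT TP.
  by have [w /TP[]] := dense_nonempty dT.
have [dTP|dTP] := dense_split (P n) dT; first by exists n.
have [|i ilt dTi] := IH _ dTP; last first.
- exists i; first exact: ltnW.
  by move=> q Jq qT; apply: dTi => // w [[Tw _] Pw]; exact: qT.
- move=> w [Tw nPw]; have [i] := TP w Tw; rewrite ltnS leq_eqVlt => /predU1P[->//|].
  by exists i.
Qed.

(** Over each point of T, the equation f = 0 is nontrivial in the coordinates l
    when those in s are fixed; it lowers the transcendence degree of l ++ s by
    one. Write f as a polynomial in the first coordinate k of l. Where some
    coefficient of positive degree is nonzero, the highest such coefficient is
    the leading one and k is algebraic. Where all the coefficients vanish, one of
    them is a nontrivial equation in the remaining coordinates and takes the place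
    of f. Only a constant coefficient being nonzero contradicts f = 0. These
    finitely many cases cover T, so one of them is dense. *)
Lemma dense_equation T s m l f :
  dense_on J T -> trdeg_le T s m -> polyon (l ++ s) f ->
  (forall w, T w -> f w = 0) ->
  (forall w, T w -> exists2 v, {in s, w =1 v} & f v != 0) ->
  exists T' m', [/\ T' `<=` T, dense_on J T', m'.+1 = (size l + m)%N &
    trdeg_le T' (l ++ s) m'].
Proof.
elim: l T f => [|k l IH] T f dT sT /= lf fT fv.
  have [w Tw] := dense_nonempty dT; have [v wv /eqP[]] := fv _ Tw.
  by rewrite -(polyon_local lf wv) fT.
have [D [a [la fa]]] := polyon_cons lf.
have free (T' : set _) : T' `<=` T -> trdeg_le T' (l ++ s) (size l + m).
  move=> T'T; elim: (l) => [|k' l' IHl]; first exact: trdeg_leW sT.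
  exact: trdeg_free.
(* The index i is the least one such that all the coefficients from a i on
   vanish; the leading coefficient is then the one before a i. *)
have [] := @dense_cover T D.+2 (fun i w => (forall j, (i <= j <= D)%N -> a j w = 0) /\
    (if i is i'.+1 then a i' w != 0 else true)) dT.
  move=> w Tw.
  have ex0 : exists i, [forall j : 'I_D.+1, (i <= j)%N ==> (a j w == 0)].
    by exists D.+1; apply/forallP => j; apply/implyP; have := ltn_ord j; lia.
  pose i := ex_minn ex0; exists i.
    rewrite /i; case: ex_minnP => i0 _ mini; rewrite ltnS mini //.
    by apply/forallP => j; apply/implyP; have := ltn_ord j; lia.
  rewrite /i; case: ex_minnP => i0 /forallP ai mini; split.
    by move=> j /andP[ij jD]; have /implyP/(_ ij)/eqP :=
      ai (Ordinal (jD : j < D.+1)%N).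
  case: i0 ai mini => // i0 ai mini; apply/negP => ai0.
  suff /mini : [forall j : 'I_D.+1, (i0 <= j)%N ==> (a j w == 0)] by rewrite ltnn.
  apply/forallP => j; apply/implyP; rewrite leq_eqVlt => /predU1P[<-//|ij].
  by have /implyP := ai j; apply.
move=> [|[|e]] eD dTe.
- have [] := @dense_cover _ D.+1
    (fun i w => exists2 v, {in s, w =1 v} & a i v != 0) dTe.
    move=> w [Tw _]; have [v wv fv0] := fv _ Tw.
    apply: contrapT => nex; case/eqP: fv0; rewrite fa big1 // => i _.
    rewrite (_ : a i v = 0) ?mul0r //; apply/eqP/negPn/negP => aiv; apply: nex.
    by exists i => //; exists v.
  move=> i iD dTi.
  have [| | | T' [m' [T'T dT' mm' trT']]] := IH _ (a i) dTi _ (la i).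
  - by apply: trdeg_leW sT => w [[]].
  - by move=> w [[_ [-> //]]].
  - by move=> w [].
  exists T', m'.+1; split=> //; first by move=> w /T'T[[]].
    by rewrite mm'.
  exact: trdeg_free.
- exfalso; have [w [Tw [aj /eqP[]]]] := dense_nonempty dTe.
  have := fT w Tw; rewrite fa big_ord_recl big1 /= ?mulr1 ?addr0 //.
  by move=> i _; rewrite aj ?mul0r //= /bump /=; have := ltn_ord i; lia.
- exists (T `&` [set w |
    (forall j, (e.+2 <= j <= D)%N -> a j w = 0) /\ a e.+1 w != 0]), (size l + m)%N.
  split=> //.
  apply: trdeg_alg; first by apply: free => w [].
  exists e, a; split=> //; first by move=> w [_ []].
  move=> w [Tw [aj _]]; rewrite -[RHS](fT w Tw) fa.
  rewrite (big_ord_widen D.+1 (fun i => a i w * w k ^+ i)) //.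
  rewrite big_mkcond /=; apply: eq_bigr => i _; case: ifPn => //.
  by rewrite -leqNgt => ei; rewrite aj ?mul0r // ei -ltnS ltn_ord.
Qed.

End Density.

(** * Gram matrices and orthogonal frames *)

Section Gram.
Context {R : realFieldType}.

Definition dotmx n (u v : 'cV[R]_n) : R := (u^T *m v) 0 0.

Lemma dotmxE n (u v : 'cV[R]_n) : u^T *m v = (dotmx u v)%:M.
Proof. exact: mx11_scalar. Qed.

Lemma dotmxC n (u v : 'cV[R]_n) : dotmx u v = dotmx v u.
Proof. by rewrite /dotmx -[u^T *m v]trmxK trmx_mul trmxK mxE. Qed.

Lemma dotmxD n (u v w : 'cV[R]_n) : dotmx u (v + w) = dotmx u v + dotmx u w.
Proof. by rewrite /dotmx mulmxDr mxE. Qed.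

Lemma dotmx_sq n (u : 'cV[R]_n) : dotmx u u = \sum_i u i 0 ^+ 2.
Proof. by rewrite /dotmx mxE; apply: eq_bigr => i _; rewrite mxE expr2. Qed.

Lemma congruence_tr r d (B : 'M[R]_(r, d)) S : (B^T *m S *m B)^T = B^T *m S^T *m B.
Proof. by rewrite !trmx_mul trmxK mulmxA. Qed.

Lemma dotmx_eq0 n (u : 'cV[R]_n) : (dotmx u u == 0) = (u == 0).
Proof.
apply/idP/idP => [|/eqP->]; last by rewrite /dotmx mulmx0 mxE.
rewrite dotmx_sq psumr_eq0 => [/allP u0|i _]; last exact: sqr_ge0.
apply/eqP/colP => i; rewrite mxE; apply/eqP; rewrite -sqrf_eq0.
by apply: u0; rewrite mem_index_enum.
Qed.

(** Over an ordered field, v H H^T v^T = |v H|^2 vanishes only for v H = 0. *)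
Lemma gram_free r d (H : 'M[R]_(r, d)) : (\det (H *m H^T) != 0) = row_free H.
Proof.
rewrite -unitfE -unitmxE -row_free_unit; apply/idP/idP => [HH|Hf].
  rewrite /row_free eqn_leq rank_leq_row /=.
  by rewrite -{1}(eqnP HH) mxrankM_maxl.
apply: inj_row_free => v vHH; apply/eqP; rewrite -(mulmx_free_eq0 _ Hf).
rewrite -trmx_eq0 -dotmx_eq0 /dotmx trmxK trmx_mul.
by rewrite mulmxA -(mulmxA v) vHH mul0mx mxE.
Qed.

Lemma dotmx_avoid n (u v : 'cV[R]_n) : u != 0 -> v != 0 ->
  exists w, (dotmx w u != 0) && (dotmx w v != 0).
Proof.
move=> u0 v0; have [uv|uv] := eqVneq (dotmx u v) 0; last first.
  by exists u; rewrite dotmx_eq0 u0.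
exists (u + v); rewrite ![dotmx (u + v) _]dotmxC !dotmxD uv dotmxC uv addr0 add0r.
by rewrite !dotmx_eq0 u0.
Qed.

Lemma free_orthogonal d r (u w : 'cV[R]_d) : (r.+1 < d)%N ->
  exists H : 'M[R]_(r, d), [/\ row_free H, H *m u = 0 & H *m w = 0].
Proof.
move=> rd; pose N := row_mx u w.
have rk : (r <= \rank (kermx N))%N.
  by rewrite mxrank_ker; have := rank_leq_col N; lia.
exists (pid_mx r *m row_base (kermx N)).
have HN : pid_mx r *m row_base (kermx N) *m N = 0 :> 'M[R]_(r, 1 + 1).
  by apply/sub_kermxP; rewrite (submx_trans (submxMl _ _)) // eq_row_base.
split.
- by rewrite /row_free mxrankMfree ?row_base_free // rank_pid_mx.
- by have := congr1 lsubmx HN; rewrite mul_mx_row row_mxKl linear0.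
- by have := congr1 rsubmx HN; rewrite mul_mx_row row_mxKr linear0.
Qed.

(** The span of the rows of G contains w, and its other directions are orthogonal
    to both v and w. The orthogonal projection onto this span therefore sends v to
    a multiple of w, as the last equation expresses. *)
Lemma orthogonal_frame d r (v w : 'cV[R]_d) : (0 < r)%N -> (r < d)%N -> w != 0 ->
  exists (G : 'M[R]_(r, d)) (z : 'cV[R]_r),
    [/\ row_free G, G^T *m z = w & G *m v = (dotmx w v / dotmx w w) *: (G *m w)].
Proof.
case: r => // r _ rd w0; have ww0 : dotmx w w != 0 by rewrite dotmx_eq0.
have [H [Hf Hv Hw]] := free_orthogonal v w rd.
pose G : 'M[R]_(1 + r, d) := col_mx w^T H.
pose z : 'cV[R]_(1 + r) := col_mx 1%:M 0.
suff: [/\ row_free G, G^T *m z = w & G *m v = (dotmx w v / dotmx w w) *: (G *m w)].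
  by exists G, z.
rewrite /G /z; split.
- rewrite -gram_free tr_col_mx mul_col_row trmxK dotmxE Hw.
  rewrite det_ublock det_scalar1 mulf_neq0 // gram_free; exact: Hf.
- by rewrite tr_col_mx mul_row_col trmxK mulmx1 mulmx0 addr0.
- rewrite !mul_col_mx Hv Hw !dotmxE scale_col_mx scaler0 scale_scalar_mx.
  by rewrite mulfVK.
Qed.

Lemma rank_factorization m n r (A : 'M[R]_(m, n)) : \rank A = r ->
  exists (C : 'M[R]_(m, r)) (B : 'M[R]_(r, n)), A = C *m B /\ row_free B.
Proof.
by move=> <-; exists (col_base A), (row_base A); rewrite mulmx_base row_base_free.
Qed.

End Gram.

(** * Rational charts of the models *)

Section Chart.
Context {R : realType}.
Variables (sym : bool) (d r : nat).
Hypothesis rd : (r <= d)%N.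

(** The boolean chooses between the two kinds of models, so that both are treated
    at once. *)
Definition model_mx : set 'M[R]_d :=
  if sym then sym_rank_mx d r else proj_rank_mx d r.

(** Two d x d matrices of parameters, of which B uses the first and T the second;
    the index type does not depend on r, so that models of different ranks have
    parameters of the same type. *)
Definition chart_idx : Type := (bool * ('I_d * 'I_d))%type.
Implicit Types (w : chart_idx -> R) (A : 'M[R]_d) (u v x y : 'cV[R]_d).

Local Notation E := (pid_mx r : 'M[R]_(d, r)).

Definition chartB w : 'M[R]_(r, d) := E^T *m \matrix_(a, b) w (false, (a, b)).
Definition chartY w : 'M[R]_r := E^T *m (\matrix_(a, b) w (true, (a, b))) *m E.
Definition chartT w : 'M[R]_r :=
  if sym then chartY w + (chartY w)^T else chartB w *m (chartB w)^T.
Definition chart w : 'M[R]_d := (chartB w)^T *m invmx (chartT w) *m chartB w.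
(** The second factor says that B has rank r ([gram_free]). *)
Definition chart_den w : R :=
  \det (chartT w) * \det (chartB w *m (chartB w)^T).
(** The polynomial numerator of the chart, of denominator det T. *)
Definition chart_num w : 'M[R]_d := (chartB w)^T *m \adj (chartT w) *m chartB w.

Lemma trE_E : E^T *m E = 1%:M.
Proof. by rewrite tr_pid_mx pid_mx_id // pid_mx_1. Qed.

Lemma sandwichE (Z : 'M[R]_r) : E^T *m (E *m Z *m E^T) *m E = Z.
Proof. by rewrite !mulmxA trE_E mul1mx -mulmxA trE_E mulmx1. Qed.

Lemma chartT_sym w : (chartT w)^T = chartT w.
Proof.
rewrite /chartT; case: sym; first by rewrite raddfD /= trmxK addrC.
by rewrite trmx_mul trmxK.
Qed.

Lemma chart_num_sym w : (chart_num w)^T = chart_num w.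
Proof. by rewrite /chart_num congruence_tr trmx_adj chartT_sym. Qed.

Lemma chart_numE w : \det (chartT w) != 0 -> chart_num w = \det (chartT w) *: chart w.
Proof.
move=> T0; rewrite /chart_num /chart /invmx unitmxE unitfE T0.
by rewrite -scalemxAr -scalemxAl scalerA divff // scale1r.
Qed.

Lemma chart_model w : chart_den w != 0 -> model_mx (chart w).
Proof.
rewrite mulf_eq0 negb_or => /andP[T0]; rewrite gram_free => Bf.
have uT : chartT w \in unitmx by rewrite unitmxE unitfE.
have chart_tr : (chart w)^T = chart w.
  by rewrite /chart congruence_tr trmx_inv chartT_sym.
have rk : \rank (chart w) = r.
  rewrite /chart mxrankMfree // mxrankMfree ?mxrank_tr; last first.
    by rewrite row_free_unit unitmx_inv.
  exact/eqnP.
rewrite /model_mx; case: ifP => s; first by split.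
have TB : chartT w = chartB w *m (chartB w)^T by rewrite /chartT s.
split=> //; have -> : chart w *m chart w = (chartB w)^T *m invmx (chartT w) *m
    (chartB w *m (chartB w)^T) *m invmx (chartT w) *m chartB w.
  by rewrite /chart !mulmxA.
by rewrite -TB mulmxK.
Qed.

Lemma chart_params (B : 'M[R]_(r, d)) (T : 'M[R]_r) : T^T = T ->
  (sym = false -> T = B *m B^T) ->
  exists w, chartB w = B /\ chartT w = T.
Proof.
move=> Tsym TB.
(* Since E^T E = 1, multiplication by E lifts B and T to d x d matrices; halving
   makes up for the symmetrization in the definition of T. *)
exists (fun k => if k.1 then (E *m (2^-1 *: T) *m E^T) k.2.1 k.2.2
                 else (E *m B) k.2.1 k.2.2).
set w := fun k => _.
have wB : chartB w = B.
  rewrite /chartB (_ : \matrix_(a, b) _ = E *m B); last first.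
    by apply/matrixP => a b; rewrite mxE.
  by rewrite mulmxA trE_E mul1mx.
split=> //; rewrite /chartT wB; case: ifP => s; last by rewrite TB ?s.
have -> : chartY w = 2^-1 *: T.
  rewrite /chartY (_ : \matrix_(a, b) _ = E *m (2^-1 *: T) *m E^T); last first.
    by apply/matrixP => a b; rewrite mxE.
  exact: sandwichE.
by rewrite linearZ /= Tsym -scalerDl -[RHS]scale1r; congr (_ *: _); lra.
Qed.

Lemma chart_den_nonzero : exists w, chart_den w != 0.
Proof.
have [|_|w [wB wT]] := @chart_params E^T 1%:M; first by rewrite trmx1.
  by rewrite trmxK trE_E.
by exists w; rewrite /chart_den wB wT trmxK trE_E det1 mulr1 oner_eq0.
Qed.

(** The measurement u^T A v is not identically zero on the model. For a rank r
    model, T = 1 and a matrix B with the single nonzero row w^T give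
    (w . u)(w . v), where w is orthogonal to neither vector. For projections of
    rank r < d the span of [orthogonal_frame] gives (w . u)(w . v) / |w|^2 up to
    the factor det T. *)
Lemma chart_nondegenerate u v : u != 0 -> v != 0 -> (0 < r)%N ->
  sym || (r < d)%N -> exists w, (u^T *m chart_num w *m v) 0 0 != 0.
Proof.
move=> u0 v0 r0 nid; have [w /andP[wu wv]] := dotmx_avoid u0 v0.
have [s|s] := boolP sym.
  pose e : 'cV[R]_r := \col_i (i == Ordinal r0)%:R.
  have ee : e^T *m e = 1%:M.
    apply/matrixP => i j; rewrite !ord1 !mxE (bigD1 (Ordinal r0)) //=.
    rewrite big1 => [|k /negbTE k0].
      by rewrite !mxE eqxx mulr1 addr0.
    by rewrite !mxE k0 mulr0.
  have [||p [pB pT]] := @chart_params (e *m w^T) 1%:M; first by rewrite trmx1.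
    by rewrite s.
  exists p; rewrite /chart_num pB pT.
  have -> : \adj 1%:M = 1%:M :> 'M[R]_r by rewrite -[LHS]mul1mx mul_mx_adj det1.
  rewrite mulmx1 trmx_mul trmxK -!mulmxA (mulmxA e^T) ee mul1mx.
  by rewrite (dotmxE w v) mul_mx_scalar -scalemxAr mxE mulf_neq0 // [_ 0 0]dotmxC.
rewrite (negbTE s) /= in nid.
have w0 : w != 0 by apply: contraNneq wu => ->; rewrite dotmxC /dotmx mulmx0 mxE.
have [G [z [Gf Gz Gv]]] := orthogonal_frame v r0 nid w0.
have [|p [pB pT]] := @chart_params G (G *m G^T) _ (fun=> erefl).
  by rewrite trmx_mul trmxK.
exists p; rewrite /chart_num pB pT -!mulmxA Gv -!scalemxAr mxE.
rewrite mulf_neq0 ?mulf_neq0 ?invr_eq0 ?dotmx_eq0 //.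
have -> : G *m w = (G *m G^T) *m z by rewrite -mulmxA Gz.
rewrite (mulmxA (\adj _)) mul_adj_mx mul_scalar_mx -!scalemxAr Gz mxE.
by rewrite mulf_neq0 ?gram_free // [_ 0 0]dotmxC.
Qed.

(** For A = B^T T^-1 B and K with B K = T, one has A K = B^T and K^T A K = T.
    Choosing K from w0 and letting A vary, B = K^T A and T = K^T A K are
    polynomial in A. They still describe A as long as K^T A K is invertible,
    because K^T A then has the row space of A. Since the parameters in w0 are
    redundant, s corrects them by the difference between the values of B and T
    at A and at w0; in this way s (chart w0) is w0 itself. *)
Lemma chart_section w0 : chart_den w0 != 0 ->
  exists s : 'M[R]_d -> chart_idx -> R,
    [/\ forall k,
          polyfun [set (fun A : 'M[R]_d => A ij.1 ij.2) | ij in setT] (s ^~ k),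
        s (chart w0) = w0 &
        forall A, model_mx A -> chart_den (s A) != 0 -> chart (s A) = A].
Proof.
rewrite mulf_eq0 negb_or => /andP[T0].
rewrite -unitfE -unitmxE => uBB.
have uT : chartT w0 \in unitmx by rewrite unitmxE unitfE.
set B0 := chartB w0 in uBB *; set T0' := chartT w0 in uT T0 *.
pose K := B0^T *m invmx (B0 *m B0^T) *m T0'.
have KA : K^T *m chart w0 = B0.
  have -> : K^T = T0' *m invmx (B0 *m B0^T) *m B0.
    rewrite /K (trmx_mul _ T0') (trmx_mul _ (invmx _)) trmxK trmx_inv.
    by rewrite (trmx_mul B0) trmxK chartT_sym mulmxA.
  have -> : T0' *m invmx (B0 *m B0^T) *m B0 *m chart w0 =
      T0' *m invmx (B0 *m B0^T) *m (B0 *m B0^T) *m invmx T0' *m B0.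
    by rewrite /chart -/B0 -/T0' !mulmxA.
  by rewrite mulmxKV // mulmxV // mul1mx.
have KAK : K^T *m chart w0 *m K = T0'.
  by rewrite KA /K !mulmxA mulmxV // mul1mx.
clearbody K.
pose M0 : 'M[R]_d := \matrix_(a, b) w0 (false, (a, b)).
pose Y0 : 'M[R]_d := \matrix_(a, b) w0 (true, (a, b)).
pose M A := M0 + E *m (K^T *m A - B0).
pose Y A := Y0 + 2^-1 *: (E *m (K^T *m A *m K - T0') *m E^T).
pose s A (k : chart_idx) : R := if k.1 then Y A k.2.1 k.2.2 else M A k.2.1 k.2.2.
exists s.
have sB A : chartB (s A) = K^T *m A.
  rewrite /chartB (_ : \matrix_(a, b) _ = M A); last first.
    by apply/matrixP => a b; rewrite mxE.
  rewrite /M (mulmxDr E^T) (mulmxA E^T E) trE_E mul1mx -[E^T *m M0]/B0.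
  by rewrite addrC subrK.
have sT A : A^T = A -> sym -> chartT (s A) = K^T *m A *m K.
  move=> As sy; rewrite /chartT sy.
  have -> : chartY (s A) = chartY w0 + 2^-1 *: (K^T *m A *m K - T0').
    rewrite /chartY (_ : \matrix_(a, b) s A _ = Y A); last first.
      by apply/matrixP => a b; rewrite mxE.
    rewrite /Y (mulmxDr E^T) mulmxDl -scalemxAr -scalemxAl; congr (_ + _ *: _).
    exact: sandwichE.
  rewrite [(_ + _)^T]linearD /= [(_ *: _)^T]linearZ /= [(_ - T0')^T]linearB /=.
  rewrite (congruence_tr K A) As [(T0')^T]chartT_sym addrACA -scalerDl.
  have -> : chartY w0 + (chartY w0)^T = T0' by rewrite /T0' /chartT sy.
  have -> : 2^-1 + 2^-1 = 1 :> R by lra.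
  by rewrite scale1r addrC subrK.
split.
- move=> [b [i j]] /=.
  have pA : polymx [set (fun A : 'M[R]_d => A ij.1 ij.2) | ij in setT] id.
    by move=> a c; apply: polyfun_gen; exists (a, c).
  case: b.
    apply: polymx_add; first exact: polymx_cst.
    apply: polymx_scale; apply: polymx_mul; last exact: polymx_cst.
    apply: polymx_mul; first exact: polymx_cst.
    apply: polymx_sub; last exact: polymx_cst.
    apply: polymx_mul; last exact: polymx_cst.
    by apply: polymx_mul => //; exact: polymx_cst.
  apply: polymx_add; first exact: polymx_cst.
  apply: polymx_mul; first exact: polymx_cst.
  apply: polymx_sub; last exact: polymx_cst.
  by apply: polymx_mul => //; exact: polymx_cst.
- apply/funext => -[b [i j]];
    rewrite /s /M /Y KAK KA !subrr !mulmx0 mul0mx scaler0 !addr0.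
  by case: b => /=; rewrite mxE.
- move=> A VA; have [As rA] : A^T = A /\ \rank A = r.
    by move: VA; rewrite /model_mx; case: sym => -[].
  have sTA : chartT (s A) = K^T *m A *m K.
    case: (boolP sym) => sy; first exact: sT.
    rewrite /chartT (negbTE sy) sB trmx_mul trmxK As !mulmxA -(mulmxA _ A A).
    by move: VA; rewrite /model_mx (negbTE sy) => -[_ <- _].
  rewrite mulf_eq0 negb_or -unitfE -unitmxE => /andP[uTA].
  rewrite gram_free => Bf; rewrite /chart sTA sB in uTA Bf *.
  have /submxP[X AX] : (A <= K^T *m A)%MS.
    by have [_ <-] := mxrank_leqif_sup (submxMl K^T A); rewrite rA.
  have AE : A = A *m K *m X^T by rewrite -[LHS]As {1}AX !trmx_mul trmxK As.
  have XE : X^T = invmx (K^T *m A *m K) *m (K^T *m A).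
    by apply: (canRL (mulKmx uTA)); rewrite {2}AE !mulmxA.
  by rewrite trmx_mul trmxK As -mulmxA -XE -AE.
Qed.

(** From a rank factorization A = C B: symmetry gives A = B^T S B with S symmetric
    invertible, and T = S^-1. For a projection, B^T (B B^T)^-1 B has the same row
    space as A, hence equals A. *)
Lemma chart_surjective A : model_mx A -> exists2 w, chart_den w != 0 & chart w = A.
Proof.
move=> VA; have [As rA] : A^T = A /\ \rank A = r.
  by move: VA; rewrite /model_mx; case: sym => -[].
have [C [B [ACB Bf]]] := rank_factorization rA.
have [F BF] := row_freeP Bf.
have CE : C = A *m F by rewrite ACB -mulmxA BF mulmx1.
have ABC : A = B^T *m C^T by rewrite -trmx_mul -ACB As.
case: (boolP sym) => sy; last first.
  have AA : A *m A = A by move: VA; rewrite /model_mx (negbTE sy) => -[_ <- _].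
  have [|w [wB wT]] := @chart_params B (B *m B^T) _ (fun=> erefl).
    by rewrite trmx_mul trmxK.
  have BB : \det (B *m B^T) != 0 by rewrite gram_free.
  exists w; rewrite /chart_den /chart wB wT ?mulf_neq0 //.
  set P := B^T *m _ *m B.
  have /row_fullP[L LC] : row_full C.
    by rewrite /row_full eqn_leq rank_leq_col -{1}rA ACB mxrankM_maxl.
  have BA : B *m A = B.
    have : C *m (B *m A) = C *m B by rewrite mulmxA -ACB.
    by move/(congr1 (mulmx L)); rewrite !mulmxA LC !mul1mx.
  have PA : P *m A = P by rewrite /P -mulmxA BA.
  rewrite -PA {1}/P ABC !mulmxA -(mulmxA _ B B^T) mulmxKV //.
  by rewrite unitmxE unitfE.
pose S := F^T *m A *m F.
have AS : A = B^T *m S *m B.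
  have AFB : A *m F *m B = A by rewrite -CE -ACB.
  by rewrite /S -!mulmxA (mulmxA A F B) AFB -{2}As -!trmx_mul AFB As.
have uS : S \in unitmx.
  rewrite -row_free_unit /row_free eqn_leq rank_leq_row -{1}rA {1}AS.
  by rewrite (leq_trans (mxrankM_maxl _ _)) // mxrankM_maxr.
have Ss : S^T = S by rewrite /S congruence_tr As.
have [||w [wB wT]] := @chart_params B (invmx S).
- by rewrite trmx_inv Ss.
- by rewrite sy.
exists w; rewrite /chart_den /chart wB wT ?invmxK //.
by rewrite mulf_neq0 ?gram_free // -unitfE -unitmxE unitmx_inv.
Qed.

Section Polynomial.
Variables (X : Type) (G : set (X -> R)) (h : X -> chart_idx -> R).
Hypothesis hG : forall k, polyfun G (h ^~ k).

Lemma polymx_chartB : polymx G (fun z => chartB (h z)).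
Proof.
apply: polymx_mul; first exact: polymx_cst.
by move=> i j; apply: polyfun_eq (hG (false, (i, j))) _ => x; rewrite mxE.
Qed.

Lemma polymx_chartT : polymx G (fun z => chartT (h z)).
Proof.
rewrite /chartT; case: sym; last first.
  by apply: polymx_mul; [|apply: polymx_tr]; exact: polymx_chartB.
have pY : polymx G (fun z => chartY (h z)).
  apply: polymx_mul; last exact: polymx_cst.
  apply: polymx_mul; first exact: polymx_cst.
  by move=> i j; apply: polyfun_eq (hG (true, (i, j))) _ => x; rewrite mxE.
by apply: polymx_add => //; exact: polymx_tr.
Qed.

Lemma polyfun_chart_den : polyfun G (fun z => chart_den (h z)).
Proof.
apply: polyfun_mul; apply: polyfun_det; first exact: polymx_chartT.
by apply: polymx_mul; [|apply: polymx_tr]; exact: polymx_chartB.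
Qed.

Lemma polymx_chart_num : polymx G (fun z => chart_num (h z)).
Proof.
apply: polymx_mul; last exact: polymx_chartB.
apply: polymx_mul; first by apply: polymx_tr; exact: polymx_chartB.
by apply: polymx_adj; exact: polymx_chartT.
Qed.

End Polynomial.

End Chart.

(** * The ambiguous triples *)

Lemma trdeg_free_cat (R : numFieldType) (K : eqType) (T : set (K -> R)) l s m :
  trdeg_le T s m -> trdeg_le T (l ++ s) (size l + m).
Proof. by move=> sT; elim: l => // k l; exact: trdeg_free. Qed.

Lemma proj_full_rank (R : realType) d (M : 'M[R]_d) : proj_rank_mx d d M -> M = 1%:M.
Proof.
move=> [_ idem rk]; have uM : M \in unitmx by rewrite -row_free_unit /row_free rk.
by rewrite -[LHS](mulKmx uM) -idem mulVmx.
Qed.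

Section Ambiguous.
Context {R : realType}.
Variables (N d : nat) (sym : 'I_N -> bool) (r : 'I_N -> nat).
Hypotheses (r_gt0 : forall j, (0 < r j)%N) (r_le : forall j, (r j <= d)%N).

Local Notation coord := (('I_N * (bool * ('I_d * 'I_d))) + (bool * 'I_d))%type.
Implicit Types (w v : coord -> R).

(** For 0 < r j <= d, the model j is {I} exactly when this fails. *)
Definition nonid j := sym j || (r j < d)%N.

Definition params w j : chart_idx d -> R := fun k => w (inl (j, k)).
Definition xvec w : 'cV[R]_d := \col_i w (inr (false, i)).
Definition yvec w : 'cV[R]_d := \col_i w (inr (true, i)).
Local Notation chartj j w := (chart (sym j) (r j) (params w j)).

(** A point is a triple: parameters of a tuple A, and vectors x and y that A does
    not distinguish although y is neither x nor - x. *)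
Definition ambiguous : set (coord -> R) :=
  [set w | [/\ yvec w <> xvec w, yvec w <> - xvec w,
    (forall j, chart_den (sym j) (r j) (params w j) != 0) &
    quad_meas (fun j => chartj j w) (yvec w) =
    quad_meas (fun j => chartj j w) (xvec w)]].

Definition xcoords : seq coord := [seq inr (false, i) | i <- enum 'I_d].
Definition ycoords : seq coord := [seq inr (true, i) | i <- enum 'I_d].
Definition pcoords j : seq coord :=
  [seq inl (j, k) | k <- enum {: bool * ('I_d * 'I_d)}].
(** The coordinates of the pairs (A, x), that is, all coordinates but those of y. *)
Definition pxcoords : seq coord :=
  flatten [seq pcoords j | j <- enum 'I_N] ++ xcoords.

Lemma size_pxcoords : size pxcoords = (N * #|{: bool * ('I_d * 'I_d)}| + d)%N.
Proof.
rewrite size_cat size_map size_enum_ord; congr (_ + _)%N.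
rewrite size_flatten /shape -map_comp.
rewrite (@eq_map _ _ _ (fun=> #|{: bool * ('I_d * 'I_d)}|)) => [|j]; last first.
  by rewrite /= size_map -cardE.
by rewrite sumnE big_map big_const_seq count_predT size_enum_ord iter_addn_0 mulnC.
Qed.

Lemma mem_pcoords j i k : ((inl (i, k) : coord) \in pcoords j) = (i == j).
Proof.
apply/mapP/eqP => [[k' _ [-> _]] //|->].
by exists k => //; rewrite mem_enum.
Qed.

Lemma mem_pcoords_xy j bi : ((inr bi : coord) \in pcoords j) = false.
Proof. by apply/mapP => -[]. Qed.

Lemma mem_xcoords i : (inr (false, i) : coord) \in xcoords.
Proof. by apply: map_f; rewrite mem_enum. Qed.

Lemma mem_ycoords i : (inr (true, i) : coord) \in ycoords.
Proof. by apply: map_f; rewrite mem_enum. Qed.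

Lemma mem_pxcoords_p j k : (inl (j, k) : coord) \in pxcoords.
Proof.
rewrite mem_cat; apply/orP; left; apply/flattenP; exists (pcoords j).
  by apply: map_f; rewrite mem_enum.
by rewrite mem_pcoords.
Qed.

Lemma uniq_pxcoords : uniq pxcoords.
Proof.
rewrite cat_uniq; apply/and3P; split.
- elim: (enum 'I_N) (enum_uniq 'I_N) => [//|j l IH] /= /andP[jl /IH ul].
  rewrite cat_uniq ul andbT; apply/andP; split.
    by rewrite map_inj_uniq ?enum_uniq // => a b [].
  apply/hasPn => k /flattenP[_ /mapP[i il ->] /mapP[a _ ->]].
  by rewrite /= mem_pcoords; apply: contraNneq jl => <-.
- apply/hasPn => _ /mapP[i _ ->]; apply/negP => /flattenP[_ /mapP[j _ ->]].
  by rewrite mem_pcoords_xy.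
- by rewrite map_inj_uniq ?enum_uniq // => a b [].
Qed.

Section Polynomials.
Variable G : set ((coord -> R) -> R).
Hypotheses (Gx : forall i, polyfun G (fun w => w (inr (false, i))))
  (Gy : forall i, polyfun G (fun w => w (inr (true, i)))).

Lemma polymx_xvec : polymx G xvec.
Proof. by move=> i j; apply: polyfun_eq (Gx i) _ => w; rewrite mxE. Qed.

Lemma polymx_yvec : polymx G yvec.
Proof. by move=> i j; apply: polyfun_eq (Gy i) _ => w; rewrite mxE. Qed.

End Polynomials.

Lemma quad_measP (A : 'I_N -> 'M[R]_d) (x y : 'cV[R]_d) j :
  quad_meas A y = quad_meas A x -> (x^T *m A j *m x) 0 0 = (y^T *m A j *m y) 0 0.
Proof. by move/rowP/(_ j); rewrite !mxE. Qed.

Lemma polarization (S : 'M[R]_d) (x y : 'cV[R]_d) : S^T = S ->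
  ((x + y)^T *m S *m (x - y)) 0 0 = (x^T *m S *m x) 0 0 - (y^T *m S *m y) 0 0.
Proof.
move=> Ss; rewrite [(x + y)^T]linearD /= !mulmxDl !mulmxBr.
have -> : y^T *m S *m x = (x^T *m S *m y)^T.
  by rewrite !trmx_mul trmxK Ss mulmxA.
by rewrite !(mxE, mulmxA) addrA subrK.
Qed.

(** The equation |x|^2 = |y|^2 imposed by the models equal to {I}. *)
Definition sphere_equation w : R := dotmx (xvec w) (xvec w) - dotmx (yvec w) (yvec w).

Definition chart_equation j w : R :=
  ((xvec w + yvec w)^T *m chart_num (sym j) (r j) (params w j) *m
   (xvec w - yvec w)) 0 0.

Lemma chart_equation_ambiguous j w : ambiguous w -> chart_equation j w = 0.
Proof.
move=> [_ _ /(_ j) den0 /(@quad_measP _ _ _ j) /= E].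
rewrite /chart_equation polarization; last exact: chart_num_sym.
rewrite chart_numE; last by move: den0; rewrite mulf_eq0 negb_or => /andP[].
have scale (z : 'cV[R]_d) a S : (z^T *m (a *: S) *m z) 0 0 = a * (z^T *m S *m z) 0 0.
  by rewrite -scalemxAr -scalemxAl mxE.
by rewrite !scale E subrr.
Qed.

Lemma chart_identity j w : ~~ nonid j -> ambiguous w -> chartj j w = 1%:M.
Proof.
rewrite negb_or -leqNgt => /andP[sj rj] [_ _ /(_ j) /chart_model + _].
move: (chartj j w) => M; rewrite /model_mx (negbTE sj) (_ : r j = d).
  exact: proj_full_rank.
by apply/eqP; rewrite eqn_leq r_le.
Qed.

Lemma sphere_equation_ambiguous j w : ~~ nonid j -> ambiguous w ->
  sphere_equation w = 0.
Proof.
move=> jid Bw; have [_ _ _ /(@quad_measP _ _ _ j)] := Bw.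
by rewrite (chart_identity jid Bw) !mulmx1 /sphere_equation /dotmx => ->;
  rewrite subrr.
Qed.

Hypotheses (d_gt0 : (0 < d)%N) (N_gt : (d < N)%N) (nonid_ge : (d <= #|nonid|)%N).

(** The pairs (x, y) have 2 d coordinates. If some model is {I}, the sphere
    equation removes one of them; otherwise all N > d models are nontrivial. In
    both cases m minus the number of nontrivial models is less than d. *)
Lemma dense_sphere : dense_on pxcoords ambiguous ->
  exists T m, [/\ T `<=` ambiguous, dense_on pxcoords T,
    trdeg_le T (ycoords ++ xcoords) m &
    (m < d + #|nonid|)%N].
Proof.
move=> dB.
have trx : trdeg_le ambiguous xcoords d.
  have := trdeg_free_cat xcoords (trdeg_nil ambiguous).
  by rewrite cats0 addn0 size_map size_enum_ord.
have szy : size ycoords = d by rewrite size_map size_enum_ord.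
have [/pred0P allnon|/pred0Pn[j jid]] := boolP (pred0b (predC nonid)).
  exists ambiguous, (d + d)%N; split=> //.
    by rewrite -[X in trdeg_le _ _ (X + _)]szy; exact: trdeg_free_cat.
  have -> : #|nonid| = N; last by rewrite ltn_add2l.
  rewrite -[RHS]card_ord; apply: eq_card => j.
  by have /negbFE := allnon j; rewrite !inE.
have [|||T [m [TB dT mE trT]]] :=
  dense_equation dB trx (_ : polyon (ycoords ++ xcoords) sphere_equation).
- have pv (V : (coord -> R) -> 'cV[R]_d) :
      polymx [set (fun w : coord -> R => w k) | k in
        [set k | k \in ycoords ++ xcoords]] V ->
    polyon (ycoords ++ xcoords) (fun w => dotmx (V w) (V w)).
    by move=> pV; apply: polymx_mul => //; exact: polymx_tr.
  apply: polyfun_sub; apply: pv.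
    by apply: polymx_xvec => i; apply: polyon_var; rewrite mem_cat mem_xcoords orbT.
  by apply: polymx_yvec => i; apply: polyon_var; rewrite mem_cat mem_ycoords.
- by move=> w; exact: sphere_equation_ambiguous jid.
(* The equation fails at y = 0 unless x = 0, and then at y = (1, ..., 1). *)
- move=> w Bw; pose c : R := (dotmx (xvec w) (xvec w) == 0)%:R.
  exists (fun k => if k is inr (true, _) then c else w k).
    by move=> _ /mapP[i _ ->].
  rewrite /sphere_equation; set v := fun k => _.
  have -> : xvec v = xvec w by apply/colP => i; rewrite !mxE.
  have -> : yvec v = const_mx c by apply/colP => i; rewrite !mxE.
  rewrite [dotmx (const_mx c) _]dotmx_sq; under eq_bigr do rewrite mxE.
  rewrite sumr_const card_ord /c; case: (dotmx (xvec w) _ =P 0) => [->|/eqP x0].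
    by rewrite expr1n sub0r oppr_eq0 pnatr_eq0 -lt0n.
  by rewrite expr0n mul0rn subr0.
exists T, m; split=> //.
by rewrite szy in mE; rewrite mE leq_add2l.
Qed.

Definition set_params w j (p : chart_idx d -> R) : coord -> R :=
  fun k => if k is inl (i, a) then if i == j then p a else w k else w k.

(** Each nontrivial model makes one of its own parameters algebraic. For given x
    and y the equation of model j is nontrivial in the parameters of j, and these
    have not been adjoined before. *)
Lemma dense_charts T m (l : seq 'I_N) : T `<=` ambiguous -> dense_on pxcoords T ->
  trdeg_le T (ycoords ++ xcoords) m -> uniq l ->
  exists T' m', [/\ T' `<=` ambiguous, dense_on pxcoords T',
    (m' + count nonid l = m + size l * #|{: bool * ('I_d * 'I_d)}|)%N &
    trdeg_le T' (flatten [seq pcoords j | j <- l] ++ (ycoords ++ xcoords)) m'].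
Proof.
move=> TB dT trT; elim: l => [|j l IH] /=.
  by exists T, m; rewrite mul0n !addn0.
move=> /andP[jl /IH[T1 [m1 [T1B dT1 E1 tr1]]]].
have szj : size (pcoords j) = #|{: bool * ('I_d * 'I_d)}| by rewrite size_map -cardE.
have [nj|nj] := boolP (nonid j); last first.
  exists T1, (size (pcoords j) + m1)%N; split=> //; first by rewrite szj; lia.
  by rewrite -catA; exact: trdeg_free_cat.
have [|||T2 [m2 [T2T1 dT2 E2 tr2]]] := dense_equation dT1 tr1
  (_ : polyon (pcoords j ++ _) (chart_equation j)).
- set s := (X in polyon X _).
  have px : polymx [set (fun w : coord -> R => w k) | k in [set k | k \in s]] xvec.
    by apply: polymx_xvec => i; apply: polyon_var;
      rewrite /s !mem_cat mem_xcoords !orbT.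
  have py : polymx [set (fun w : coord -> R => w k) | k in [set k | k \in s]] yvec.
    by apply: polymx_yvec => i; apply: polyon_var;
      rewrite /s !mem_cat mem_ycoords !orbT.
  apply: polymx_mul; last exact: (polymx_sub px py).
  apply: polymx_mul; first by apply: polymx_tr; exact: (polymx_add px py).
  by apply: polymx_chart_num => k; apply: polyon_var;
    rewrite /s mem_cat mem_pcoords eqxx.
- by move=> w /T1B; exact: chart_equation_ambiguous.
- move=> w /T1B[yx yNx _ _].
  have u0 : xvec w + yvec w != 0.
    by apply/eqP => /eqP; rewrite addrC addr_eq0 => /eqP.
  have v0 : xvec w - yvec w != 0.
    by apply/eqP => /eqP; rewrite subr_eq0 => /eqP/esym.
  have [p pP] := chart_nondegenerate (r_le j) u0 v0 (r_gt0 j) nj.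
  exists (set_params w j p).
    move=> k; rewrite mem_cat => /orP[|].
      move=> /flattenP[_ /mapP[i il ->] /mapP[a _ ->]] /=.
      by case: eqP => // ij; rewrite -ij il in jl.
    by rewrite mem_cat => /orP[] /mapP[a _ ->].
  rewrite /chart_equation.
  have -> : xvec (set_params w j p) = xvec w by apply/colP => i; rewrite !mxE.
  have -> : yvec (set_params w j p) = yvec w by apply/colP => i; rewrite !mxE.
  have -> // : params (set_params w j p) j = p.
  by apply/funext => k; rewrite /params /= eqxx.
exists T2, m2; split=> //.
- by move=> w /T2T1 /T1B.
- by move: E2; rewrite szj; lia.
- by rewrite -catA.
Qed.

(** Otherwise the coordinates of the pairs (A, x) would be more numerous than the
    transcendence degree allows. *)
Lemma ambiguous_not_dense : ~ dense_on pxcoords ambiguous.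
Proof.
move=> /dense_sphere[T [m [TB dT trT mlt]]].
have [T' [m' [_ dT' E trT']]] := dense_charts TB dT trT (enum_uniq 'I_N).
have cnt : count nonid (enum 'I_N) = #|nonid| by rewrite -size_filter cardE enumT.
rewrite cnt size_enum_ord in E.
have [] := trdeg_dependent trT' _ uniq_pxcoords.
- move=> k; rewrite !mem_cat => /orP[->//|->]; by rewrite !orbT.
- by rewrite size_pxcoords; lia.
- by move=> q [Jq [w /eqP qw] qT]; apply: qw; exact: dT' Jq qT w.
Qed.

End Ambiguous.

(** * A polynomial certificate *)

Definition mx_entries (R : realType) N d : set (('I_N -> 'M[R]_d) -> R) :=
  [set (fun A : 'I_N -> 'M[R]_d => A k.1 k.2.1 k.2.2) |
    k in [set: 'I_N * ('I_d * 'I_d)]].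
Arguments mx_entries {R} N d.

Section GenericPolynomial.
Context {R : realType}.
Variables (N d : nat) (sym : 'I_N -> bool) (r : 'I_N -> nat).
Hypotheses (r_gt0 : forall j, (0 < r j)%N) (r_le : forall j, (r j <= d)%N).
Hypotheses (d_gt0 : (0 < d)%N) (N_gt : (d < N)%N)
  (nonid_ge : (d <= #|nonid d sym r|)%N).

Local Notation coord := (('I_N * (bool * ('I_d * 'I_d))) + (bool * 'I_d))%type.
Local Notation pxcoords := (pxcoords N d).
Implicit Types (w v : coord -> R).

Definition glue (p : 'I_N -> chart_idx d -> R) (x y : 'cV[R]_d) : coord -> R :=
  fun k => match k with
    | inl (j, a) => p j a
    | inr (false, i) => x i 0
    | inr (true, i) => y i 0
    end.

Lemma chart_den_polyon j : polyon pxcoords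
  (fun w : coord -> R => chart_den (sym j) (r j) (params w j)).
Proof.
by apply: polyfun_chart_den => k; apply: polyon_var; exact: mem_pxcoords_p.
Qed.

Lemma ambiguous_polynomial : exists q, [/\ polyon pxcoords q, exists w, q w != 0 &
  forall w, q w != 0 ->
    (forall j, chart_den (sym j) (r j) (params w j) != 0) /\ ~ ambiguous sym r w].
Proof.
have := ambiguous_not_dense (R := R) r_gt0 r_le d_gt0 N_gt nonid_ge.
rewrite /dense_on => /existsNP[q].
move=> /not_implyP[Jq /not_implyP[q0 /existsNP[w /eqP qw]]].
have den_nonzero j : exists w : coord -> R, chart_den (sym j) (r j) (params w j) != 0.
  by have [p p0] := @chart_den_nonzero R (sym j) d (r j) (r_le j);
    exists (glue (fun=> p) 0 0).
have [v v0] := polyon_nonzero_prod (index_enum 'I_N) chart_den_polyon den_nonzero.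
have prodP : polyon pxcoords
    (fun w : coord -> R => \prod_j chart_den (sym j) (r j) (params w j)).
  by apply: polyfun_prod; exact: chart_den_polyon.
have [u u0] := polyon_nonzero_mul Jq prodP qw v0.
exists (fun w => q w * \prod_j chart_den (sym j) (r j) (params w j)); split.
- exact: polyfun_mul.
- by exists u.
- move=> z; rewrite mulf_eq0 negb_or => /andP[qz pz]; split.
    by move=> j; move: pz; rewrite (bigD1 j) //= mulf_eq0 negb_or => /andP[].
  by move=> /q0 E; rewrite E eqxx in qz.
Qed.

(** F is q at a fixed x0, with the parameters of A given by sections that pass
    through a point w0 where q is nonzero. This makes F nonzero at the image of w0.
    When F A is nonzero, so is the polynomial g = q(A, _), which takes the same
    value at x0. *)
Lemma generic_polynomial : exists F,
  [/\ polyfun (mx_entries N d) F,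
      exists2 A, (forall j, model_mx (sym j) (r j) (A j)) & F A != 0 &
      forall A, (forall j, model_mx (sym j) (r j) (A j)) -> F A != 0 ->
        exists g : ('I_d -> R) -> R, [/\ polyon (enum 'I_d) g, exists x, g x != 0 &
          forall x, g x != 0 -> forall y, quad_meas A y = quad_meas A (\col_i x i) ->
            y = \col_i x i \/ y = - \col_i x i]].
Proof.
have [q [Jq [w0 qw0] qP]] := ambiguous_polynomial.
have [den0 _] := qP _ qw0.
have /choice[s sP] : forall j, exists s : 'M[R]_d -> chart_idx d -> R,
    [/\ forall k,
          polyfun [set (fun A : 'M[R]_d => A ij.1 ij.2) | ij in setT] (s ^~ k),
        s (chart (sym j) (r j) (params w0 j)) = params w0 j &
        forall A, model_mx (sym j) (r j) A -> chart_den (sym j) (r j) (s A) != 0 ->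
          chart (sym j) (r j) (s A) = A].
  by move=> j; exact: chart_section.
pose S A x y := glue (fun j => s j (A j)) x y.
exists (fun A => q (S A (xvec w0) 0)); split.
- apply: (@polyfun_comp _ _ _ _ _ (fun A => S A (xvec w0) 0) q _ Jq) =>
    _ [[[j a]|[b i]] k <-] /=.
    have [pj _ _] := sP j.
    apply: (@polyfun_comp _ _ _ _ _
      (fun A : 'I_N -> 'M[R]_d => A j) (s j ^~ a) _ (pj a)).
    by move=> _ [ij _ <-]; apply: polyfun_gen; exists (j, ij).
  by rewrite /S /=; case: b {k}; exact: polyfun_cst.
- exists (fun j => chart (sym j) (r j) (params w0 j)).
    by move=> j; exact: chart_model.
  congr (_ != 0) : qw0; apply: polyon_local Jq _ => k.
  rewrite mem_cat => /orP[/flattenP[_ /mapP[j _ ->] /mapP[a _ ->]]|/mapP[i _ ->]] /=.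
    by have [_ -> _] := sP j.
  by rewrite mxE.
- move=> A VA FA; have [denA _] := qP _ FA.
  have chartA j : chart (sym j) (r j) (s j (A j)) = A j.
    by have [_ _ ->] := sP j; [| |exact: denA].
  exists (fun x => q (S A (\col_i x i) 0)); split.
  + apply: (@polyfun_comp _ _ _ _ _
      (fun x : 'I_d -> R => S A (\col_i x i) 0) q _ Jq) =>
      _ [[[j a]|[[|] i]] k <-] /=.
    * exact: polyfun_cst.
    * by apply: polyfun_eq (polyfun_cst _ 0) _ => x; rewrite /S /= mxE.
    * by apply: polyfun_eq (polyon_var (mem_enum _ i)) _ => x; rewrite /S /= mxE.
  + exists (fun i => xvec w0 i 0); rewrite (_ : \col_i _ = xvec w0) //.
    by apply/colP => i; rewrite mxE.
  + move=> x qx y yx.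
    have : q (S A (\col_i x i) y) != 0.
      congr (_ != 0) : qx; apply: polyon_local Jq _ => k.
      rewrite mem_cat => /orP[/flattenP[_ /mapP[j _ ->] /mapP[a _ ->]] //|].
      by move=> /mapP[i _ ->].
    move=> /qP[_ nbad]; apply: contrapT => /not_orP[yNx yNNx]; apply: nbad.
    have Ex : xvec (S A (\col_i x i) y) = \col_i x i.
      by apply/colP => i; rewrite !mxE /S /= ?mxE.
    have Ey : yvec (S A (\col_i x i) y) = y.
      by apply/colP => i; rewrite !mxE /S /= ?mxE.
    split; rewrite ?Ex ?Ey //.
    rewrite (_ : (fun j => _) = A) //; apply/funext => j; exact: chartA.
Qed.

End GenericPolynomial.

(** * Zeros of polynomials are null sets *)

Section NullSet.
Context {R : realType}.
Local Notation mR := (measurableTypeR R).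

Definition tuple_entries n : set (n.-tuple mR -> R) :=
  [set (fun t => tnth t i) | i in setT].

Lemma finite_poly_roots (p : {poly R}) : p != 0 -> finite_set [set x | p.[x] = 0].
Proof.
move=> p0; apply: contrapT => /(infinite_set_fset (size p))[B Bp].
rewrite leqNgt => /negP; apply; apply: max_poly_roots p0 _ (finmap.fset_uniq B).
by apply/allP => x /Bp /= px; apply/rootP.
Qed.

Lemma polyfun_measurable n (f : n.-tuple mR -> R) :
  polyfun (@tuple_entries n) f -> measurable_fun setT f.
Proof.
elim=> [_ [i _ <-]|c|a b _ ma _ mb|a b _ ma _ mb].
- exact: measurable_tnth.
- exact: measurable_cst.
- exact: measurable_funD.
- exact: measurable_funM.
Qed.

Lemma measurable_zeros n (f : n.-tuple mR -> R) :
  polyfun (@tuple_entries n) f -> measurable [set t | f t = 0].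
Proof.
move=> /polyfun_measurable mf; rewrite -[X in measurable X]setTI.
exact: mf measurableT _ (measurable_set1 0).
Qed.

(** By Fubini: if f is nonzero at (a0, t0), then f(_, t0) has finitely many zeros,
    and for every other a the section f(a, _) is a nonzero polynomial in one
    variable less. *)
Lemma polyfun_zeros_null n (f : n.-tuple mR -> R) :
  polyfun (@tuple_entries n) f -> (exists t, f t != 0) ->
  lebesgue_tuple n [set t | f t = 0] = 0%E.
Proof.
elim: n f => [|n IH] f pf [t0 ft0].
  rewrite (_ : [set _ | _] = set0) ?measure0 //.
  by apply/seteqP; split=> // t /= ft; rewrite (tuple0 t0) -(tuple0 t) ft eqxx in ft0.
have section a : polyfun (@tuple_entries n) (fun t' => f (tuple_cons (a, t'))).
  apply: (@polyfun_comp _ _ _ _ _ (fun t' => tuple_cons (a, t')) _ _ pf) =>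
    _ [i _ <-].
  case: (unliftP ord0 i) => [j ->|->].
    by apply: (@polyfun_eq _ _ _ (fun t => tnth t j)) => [|t] /=;
      [apply: polyfun_gen; exists j | rewrite tnthS].
  exact: polyfun_cst.
have [p pE] : exists p : {poly R},
    forall a, f (tuple_cons (a, (tuple_uncons t0).2)) = p.[a].
  apply: (@polyfun_along _ _ _
    (fun a => tuple_cons (a, (tuple_uncons t0).2)) _ _ pf) => _ [i _ <-].
  case: (unliftP ord0 i) => [j ->|->].
    by exists (tnth (tuple_uncons t0).2 j)%:P => a; rewrite tnthS hornerC.
  by exists 'X => a; rewrite hornerX.
have p0 : p != 0.
  apply: contraNneq ft0 => p0; have := pE (tuple_uncons t0).1;
    rewrite p0 horner0 => <-.
  by apply/eqP; congr f; rewrite [LHS]tuple_eta; exact: val_inj.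
pose Z := tuple_cons (n := n) @^-1` [set t | f t = 0].
have mZ : measurable Z.
  rewrite -[X in measurable X]setTI; apply: measurable_tuple_cons => //.
  exact: measurable_zeros.
rewrite /= /lebesgue_cons /pushforward -/Z /product_measure1.
transitivity (\int[@lebesgue_measure R]_x (cst 0%E x))%E; last by rewrite integral0.
apply: ge0_ae_eq_integral => //; first exact: measurable_fun_xsection.
have ZE : ysection Z (tuple_uncons t0).2 = [set a | p.[a] = 0].
  by apply/seteqP; split=> a; rewrite /ysection /= inE /Z /= pE.
exists (ysection Z (tuple_uncons t0).2); split.
- exact: measurable_ysection.
- rewrite ZE; apply: countable_lebesgue_measure0; apply: finite_set_countable.
  exact: finite_poly_roots.
- rewrite ZE => a /= /not_implyP[_ Ha]; apply: contrapT => pa; apply: Ha.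
  rewrite -[RHS](IH _ (section a)).
    by congr (lebesgue_tuple n _); apply/seteqP; split=> t; rewrite /xsection /= inE.
  by exists (tuple_uncons t0).2; rewrite pE; apply/eqP.
Qed.

End NullSet.

(** * Almost everywhere phase retrieval *)

Section AlmostEverywhere.
Context {R : realType}.

Lemma polynomial_ae_phase_retrieval N d (A : 'I_N -> 'M[R]_d) g :
  polyon (enum 'I_d) g -> (exists x, g x != 0) ->
  (forall x, g x != 0 -> forall y, quad_meas A y = quad_meas A (\col_i x i) ->
    y = \col_i x i \/ y = - \col_i x i) ->
  ae_phase_retrieval A.
Proof.
move=> pg [x gx] gP.
have pf : polyfun (@tuple_entries R d) (fun t => g (tnth t)).
  apply: (@polyfun_comp _ _ _ _ _
    (fun t : d.-tuple (measurableTypeR R) => tnth t) _ _ pg) => _ [i _ <-].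
  by apply: polyfun_gen; exists i.
exists [set t | g (tnth t) = 0]; split.
- exact: measurable_zeros.
- apply: polyfun_zeros_null => //; exists [tuple x i | i < d].
  congr (g _ != 0) : gx; apply/funext => i.
  by rewrite tnth_map tnth_ord_tuple.
- move=> t /= nPR; apply: contrapT => /eqP gt0; apply: nPR => y.
  exact: gP gt0 y.
Qed.

Lemma generic_ae_phase_retrieval N d (sym : 'I_N -> bool) (r : 'I_N -> nat) :
  (forall j, (0 < r j)%N) -> (forall j, (r j <= d)%N) -> (0 < d)%N -> (d < N)%N ->
  (d <= #|nonid d sym r|)%N ->
  exists F, [/\ polyfun (mx_entries N d) F,
    exists2 A : 'I_N -> 'M[R]_d, (forall j, model_mx (sym j) (r j) (A j)) & F A != 0 &
    forall A, (forall j, model_mx (sym j) (r j) (A j)) -> F A != 0 ->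
      ae_phase_retrieval A].
Proof.
move=> r0 rd d0 dN nid; have [F [pF F0 FP]] :=
  @generic_polynomial R N d sym r r0 rd d0 dN nid.
exists F; split=> // A VA /(FP A VA)[g [pg g0 gP]].
exact: polynomial_ae_phase_retrieval gP.
Qed.

Lemma exists_upper_idx d (a b : 'I_d) :
  exists u : upper_idx d, val u = (a, b) \/ val u = (b, a).
Proof.
case: (leqP a b) => ab; first by exists (exist _ (a, b) ab); left.
by exists (exist (fun ij : 'I_d * 'I_d => is_true (ij.1 <= ij.2)%N)
  (b, a) (ltnW ab)); right.
Qed.

(** A tuple of symmetric matrices depends linearly on its upper triangular
    entries, so polynomials in the matrices are polynomials in the coordinates
    that carry the Lebesgue measure. *)
Lemma sym_coords_inverse N d :
  exists S : #|{: 'I_N * upper_idx d}|.-tuple (measurableTypeR R) -> 'I_N -> 'M[R]_d,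
  (forall j a b, exists k, forall t, S t j a b = tnth t k) /\
  (forall A : 'I_N -> 'M[R]_d, (forall j, sym_mx (A j)) -> S (sym_coords A) = A).
Proof.
have /choice[u uP] : forall ab : 'I_d * 'I_d, exists u : upper_idx d,
    val u = (ab.1, ab.2) \/ val u = (ab.2, ab.1).
  by move=> ab; exact: exists_upper_idx.
exists (fun t j => \matrix_(a, b) tnth t (enum_rank (j, u (a, b)))); split.
  by move=> j a b; exists (enum_rank (j, u (a, b))) => t; rewrite mxE.
move=> A As; apply/funext => j; apply/matrixP => a b.
rewrite mxE tnth_map tnth_ord_tuple enum_rankK /=.
by have [->|->] := uP (a, b) => //=; rewrite -{1}(As j) mxE.
Qed.

Lemma random_symmetric_ae_phase_retrieval N d (dT : measure_display)
    (T : measurableType dT) (P : probability T R) (A : T -> 'I_N -> 'M[R]_d) :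
  (d < N)%N -> abs_cont_random_sym P A -> {ae P, forall w, ae_phase_retrieval (A w)}.
Proof.
move=> dN [As mA acA]; case: d => [|d] in A dN As mA acA *.
  apply: aeW => w; apply: aeW => t y _; left.
  by apply/matrixP => -[].
have nid : (d < #|nonid d.+1 (fun _ : 'I_N => true) (fun=> d.+1)|)%N.
  by rewrite (_ : #|_| = N) 1?ltnW // -[RHS]card_ord; apply: eq_card.
have [F [pF [A0 VA0 FA0] FP]] := @generic_ae_phase_retrieval N d.+1
  (fun=> true) (fun=> d.+1) (fun=> isT) (fun=> leqnn _) isT dN nid.
have [S [Sk SA]] := sym_coords_inverse N d.+1.
(* The determinants single out the tuples of matrices of rank d. *)
pose G A := F A * \prod_j \det (A j : 'M[R]_d.+1).
pose f t := G (S t).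
have pG : polyfun (mx_entries N d.+1) G.
  apply: polyfun_mul => //; apply: polyfun_prod => j; apply: polyfun_det => a b.
  by apply: polyfun_gen; exists (j, (a, b)).
have pf : polyfun (@tuple_entries R _) f.
  apply: (@polyfun_comp _ _ _ _ _ S _ _ pG) => _ [[j [a b]] _ <-] /=.
  have [k kP] := Sk j a b; apply: (@polyfun_eq _ _ _ (fun t => tnth t k)) => [|t].
    by apply: polyfun_gen; exists k.
  by rewrite -kP.
have f0 : exists t, f t != 0.
  exists (sym_coords A0); rewrite /f SA => [|j]; last exact: (VA0 j).1.
  rewrite mulf_neq0 // prodf_seq_neq0; apply/allP => j _ /=.
  rewrite -unitfE -unitmxE -row_free_unit /row_free; apply/eqP.
  by have [] := VA0 j.
exists ((fun w => sym_coords (A w)) @^-1` [set t | f t = 0]); split.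
- by rewrite -[X in measurable X]setTI; apply: mA => //; exact: measurable_zeros.
- move/null_content_dominatesP : acA => /(_ _ (measurable_zeros pf)).
  by apply; exact: polyfun_zeros_null.
- move=> w /= nPR; apply: contrapT => /eqP; rewrite /f SA // => fw.
  move: fw; rewrite /G mulf_eq0 negb_or => /andP[Fw Dw]; apply: nPR.
  apply: FP Fw => j; split=> //; apply: mxrank_unit; rewrite unitmxE unitfE.
  by move: Dw; rewrite (bigD1 j) //= mulf_eq0 negb_or => /andP[].
Qed.

End AlmostEverywhere.

(** * Strict subsets of irreducible sets have smaller dimension *)

Section KrullDimension.
Context {R : realType} {n : nat}.
Local Notation Rn := (mpoly.mpoly n R).
Implicit Types (p f : Rn) (S : set ('I_n -> R)).

(** The shift turns msize (p * q) <= msize p + msize q + 1 into subadditivity,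
    with no exception for the zero polynomial. *)
Definition msizeS p := (mpoly.msize p).+1.

Lemma msizeS_mul p f : (msizeS (p * f)%R <= msizeS p + msizeS f)%N.
Proof. by rewrite /msizeS addSn addnS ltnS; exact: mpoly.msizeM_le. Qed.

Lemma msizeS_exp p a : (msizeS (p ^+ a) <= a * msizeS p + 2)%N.
Proof.
elim: a => [|a IH]; first by rewrite expr0 /msizeS mpoly.msize1.
by rewrite exprS (leq_trans (msizeS_mul _ _)) // mulSn -addnA leq_add2l.
Qed.

Lemma msizeS_digit_monomial D (s : nat) (fs : seq Rn) i :
  (forall f, f \in fs -> msizeS f <= s)%N -> (i < D ^ size fs)%N ->
  (msizeS (digit_monomial D fs i) <= size fs * (D * s + 2) + 2)%N.
Proof.
elim: fs i => [|f fs IH] i fss /=; first by rewrite /msizeS mpoly.msize1.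
rewrite expnS => iD.
have D0 : (0 < D ^ size fs)%N by move: iD; case: (D ^ size fs)%N; rewrite ?muln0.
rewrite (leq_trans (msizeS_mul _ _)) // mulSn -addnA leq_add //; last first.
  by apply: IH; [move=> g gf; apply: fss; rewrite inE gf orbT | rewrite ltn_mod].
rewrite (leq_trans (msizeS_exp _ _)) // leq_add2r leq_mul //.
  by rewrite ltnW // ltn_divLR.
by apply: fss; rewrite mem_head.
Qed.

(** The D^k monomials in the k > n polynomials fs have degree at most a constant
    times D, hence lie in a space of dimension O(D^n). *)
Lemma mpoly_dependent k (fs : seq Rn) : size fs = k -> (n < k)%N ->
  exists (D : nat) (c : 'I_(D ^ k) -> R),
    (exists i, c i != 0) /\ \sum_i c i *: digit_monomial D fs i = 0.
Proof.
move=> fsk nk; pose s := \sum_(f <- fs) msizeS f.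
have fss f : f \in fs -> (msizeS f <= s)%N.
  by move=> ffs; rewrite /s (big_rem f) //= leq_addr.
(* B bounds the sizes of the monomials, and B <= D C, so that C^n < D suffices. *)
pose C := (k * (s + 2) + 2)%N; pose D := (C ^ n).+1.
pose B := (k * (D * s + 2) + 2)%N.
have BD : (#|{: {ffun 'I_n -> 'I_B}}| < D ^ k)%N.
  rewrite card_ffun !card_ord (@leq_ltn_trans ((D * C) ^ n)) //.
    by rewrite leq_expr2 // /B /C; nia.
  rewrite expnMn (@leq_trans (D ^ n.+1)) ?leq_pexp2l //.
  by rewrite expnSr ltn_pmul2l // expn_gt0.
pose mon (e : {ffun 'I_n -> 'I_B}) := mpoly.Multinom [tuple nat_of_ord (e i) | i < n].
pose u : 'M[R]_(D ^ k, #|{: {ffun 'I_n -> 'I_B}}|) :=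
  \matrix_(i, j) mpoly.mcoeff (mon (enum_val j)) (digit_monomial D fs i).
have [c c0 cu] := linear_dependency u BD.
exists D, (fun i => c 0 i); split.
  apply: contrapT => /forallNP c00; case/eqP: c0; apply/rowP => i; rewrite mxE.
  by apply/eqP/negPn/negP.
apply/mpoly.mpolyP => m; rewrite mpoly.mcoeff0 raddf_sum /=.
under eq_bigr do rewrite mpoly.mcoeffZ.
have [mB|mB] := ltnP (mpoly.mdeg m) B; last first.
  rewrite big1 // => i _; rewrite mpoly.memN_msupp_eq0 ?mulr0 //.
  apply: mpoly.msize_mdeg_ge; apply: leq_trans mB.
  have := @msizeS_digit_monomial D s fs i fss; rewrite fsk => /(_ (ltn_ord i)).
  by move/ltnW.
have mi i : (m i < B)%N.
  by apply: leq_ltn_trans mB; rewrite mpoly.mdegE (bigD1 i) //= leq_addr.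
pose e : {ffun 'I_n -> 'I_B} := [ffun i => Ordinal (mi i)].
have me : mon e = m.
  by apply/mpoly.mnmP => i; rewrite mpoly.multinomE tnth_map tnth_ord_tuple ffunE.
have /rowP/(_ (enum_rank e)) := cu; rewrite !mxE => cue; rewrite -[RHS]cue.
by apply: eq_bigr => i _; rewrite mxE enum_rankK me.
Qed.

Section Chain.
Variables (k : nat) (P : nat -> prime_idealr Rn) (f : nat -> Rn).
Hypotheses (PS : forall i, (i < k)%N -> {subset P i <= P i.+1})
  (fP : forall i, (i < k)%N -> f i \in P i.+1)
  (fNP : forall i, (i < k)%N -> f i \notin P i).

(** Modulo the larger prime I', only the constant term g 0 survives, so it is zero
    by assumption; then h can be cancelled modulo I. *)
Lemma prime_power_expansion (I I' : prime_idealr Rn) (h : Rn) (D : nat)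
    (g : nat -> Rn) :
  {subset I <= I'} -> h \in I' -> h \notin I ->
  (forall a, (a < D)%N -> g a \in I' -> g a = 0) ->
  \sum_(a < D) h ^+ a * g a \in I -> forall a, (a < D)%N -> g a = 0.
Proof.
move=> II' hI' hI; elim: D g => // D IH g g0.
rewrite big_ord_recl /= mul1r => sumI.
have E : \sum_(i < D) h ^+ bump 0 i * g (bump 0 i) = h * \sum_(i < D) h ^+ i * g i.+1.
  by rewrite mulr_sumr; apply: eq_bigr => i _; rewrite mulrA -exprS.
rewrite E in sumI.
have g00 : g 0%N = 0.
  apply: g0 => //; have := II' _ sumI.
  rewrite rpredDr // mulrC; exact: idealMr.
move: sumI; rewrite g00 add0r prime_idealrM (negbTE hI) /= => sumI.
by move=> [//|a] aD; apply: (IH (fun a => g a.+1)) => // b bD; apply: g0.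
Qed.

(** Algebraic independence modulo P (k - m) of polynomials chosen in the gaps of
    the chain above it. A relation is expanded in powers of the one in the lowest
    gap; its coefficients are polynomials in the others, which the induction
    hypothesis shows to be independent modulo the next prime. *)
Lemma chain_independent (D m : nat) (c : nat -> R) : (m <= k)%N ->
  \sum_(i < D ^ m) c i *: digit_monomial D [seq f i | i <- iota (k - m) m] i
    \in P (k - m)%N ->
  forall i, (i < D ^ m)%N -> c i = 0.
Proof.
elim: m c => [|m IH] c mk.
  rewrite subn0 big_ord_recl big_ord0 addr0 /= => cP [|//] _.
  apply: contrapT => /eqP c0; have := idealMr ((c 0%N)^-1 *: 1) cP.
  by rewrite -scalerAl mul1r scalerA mulVf // scale1r idealr1.
have km : (k - m.+1 < k)%N by lia.
have kmS : (k - m = (k - m.+1).+1)%N by lia.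
have [D0|D0] := posnP (D ^ m)%N; first by rewrite expnS D0 muln0.
pose g a := \sum_(b < D ^ m)
  c (a * D ^ m + b)%N *: digit_monomial D [seq f i | i <- iota (k - m) m] b.
rewrite /= -kmS.
have -> : \sum_(i < D ^ m.+1) c i *:
    (f (k - m.+1)%N ^+ (i %/ D ^ size [seq f i | i <- iota (k - m) m]) *
     digit_monomial D [seq f i | i <- iota (k - m) m]
       (i %% D ^ size [seq f i | i <- iota (k - m) m])) =
    \sum_(a < D) f (k - m.+1)%N ^+ a * g a.
  rewrite size_map size_iota -[LHS](big_mkord xpredT
    (fun i => c i *: (f _ ^+ (i %/ D ^ m) * _ (i %% D ^ m)%N))).
  rewrite expnS big_nat_mul big_mkord; apply: eq_bigr => a _.
  rewrite /g mulr_sumr -{1}[(a * D ^ m)%N]add0n big_addn.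
  have -> : (a.+1 * D ^ m - a * D ^ m = D ^ m)%N by rewrite mulSn addnK.
  rewrite big_mkord.
  apply: eq_bigr => b _; rewrite -scalerAr [(b + _)%N]addnC.
  by rewrite divnMDl // divn_small // addn0 modnMDl modn_small.
move=> sumP i iD; rewrite (divn_eq i (D ^ m)).
have gE := @prime_power_expansion (P (k - m.+1)%N) (P (k - m)%N) (f (k - m.+1)%N) D g.
have g0 a : (a < D)%N -> g a = 0.
  apply: gE => //; rewrite ?kmS; [exact: PS|exact: fP|exact: fNP|].
  rewrite -kmS => b bD gP; rewrite /g big1 // => j _.
  by rewrite (IH (fun j => c (b * D ^ m + j)%N)) ?scale0r // ltnW.
apply: (IH (fun b => c (i %/ D ^ m * D ^ m + b)%N));
  [exact: ltnW| |by rewrite ltn_mod].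
have := g0 (i %/ D ^ m)%N; rewrite ltn_divLR // -expnS => /(_ iD) gi.
by rewrite -/(g _) gi idealr0.
Qed.

Lemma chain_length_le : (k <= n)%N.
Proof.
rewrite leqNgt; apply/negP => nk.
have [|D [c [[i ci] cE]]] := @mpoly_dependent k [seq f i | i <- iota 0 k] _ nk.
  by rewrite size_map size_iota.
pose c' j := oapp c 0 (insub j).
have := @chain_independent D k c' (leqnn _); rewrite subnn.
have -> : \sum_(i < D ^ k) c' i *: digit_monomial D [seq f i | i <- iota 0 k] i = 0.
  by rewrite -[RHS]cE; apply: eq_bigr => j _; rewrite /c' valK.
move=> /(_ (idealr0 _) i (ltn_ord i)); rewrite /c' valK /= => ci0.
by rewrite ci0 eqxx in ci.
Qed.

End Chain.

(** The Krull dimension of a polynomial ring in n variables is at most n. *)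
Lemma prime_chain_le S k P : prime_chain S k P -> (k <= n)%N.
Proof.
move=> [_ PS].
have /choice[f fP] : forall i, exists p : Rn, (i < k)%N ->
  p \in P i.+1 /\ p \notin P i.
  move=> i; case: (ltnP i k) => ik; last by exists 0.
  by have [_ [p pP pNP]] := PS i ik; exists p.
apply: (@chain_length_le k P f) => i ik.
- by have [] := PS i ik.
- by have [] := fP i ik.
- by have [] := fP i ik.
Qed.

(** The ideal of an irreducible set is prime; irreducibility is stated as the
    absence of zero divisors among polynomial functions on S. *)
Lemma vanishing_prime S : (exists x, S x) ->
  (forall p f, (exists2 x, S x & mpoly.meval x p != 0) ->
    (exists2 x, S x & mpoly.meval x f != 0) ->
    exists2 x, S x & mpoly.meval x p * mpoly.meval x f != 0) ->
  exists I : prime_idealr Rn, forall p, (p \in I) = `[< vanishes_on S p >].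
Proof.
move=> [x0 Sx0] irr; pose V (p : Rn) : bool := `[< vanishes_on S p >].
have hI : idealr_closed V.
  split.
  - by apply/asboolP => x _; rewrite mpoly.meval0.
  - by apply/negP => /asboolP/(_ _ Sx0)/eqP; rewrite mpoly.meval1 oner_eq0.
  - move=> a p f /asboolP Vp /asboolP Vf; apply/asboolP => x Sx.
    by rewrite mpoly.mevalD mpoly.mevalM Vp // Vf // mulr0 addr0.
have nV p : ~ V p -> exists2 x, S x & mpoly.meval x p != 0.
  move=> nVp; apply: contrapT => nex; apply: nVp; apply/asboolP => x Sx.
  by apply/eqP/negPn/negP => px; apply: nex; exists x.
have hP : prime_idealr_closed V.
  move=> p f /asboolP Vpf; apply/orP; apply: contrapT => /not_orP[/nV p0 /nV f0].
  have [x Sx] := irr _ _ p0 f0.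
  by rewrite -mpoly.mevalM Vpf // eqxx.
pose I : prime_idealr Rn :=
  HB.pack V (isIdealr.Build _ V hI) (isPrimeIdealrClosed.Build _ V hP).
by exists I.
Qed.

(** The ideal of S can be put below any chain for S', strictly because of p. As
    chains have at most n steps, a longest one exists unless S' has none, and it
    is strictly shorter than some chain for S. *)
Lemma real_dim_drop S S' p : S' `<=` S -> (exists x, S x) ->
  (forall p f, (exists2 x, S x & mpoly.meval x p != 0) ->
    (exists2 x, S x & mpoly.meval x f != 0) ->
    exists2 x, S x & mpoly.meval x p * mpoly.meval x f != 0) ->
  vanishes_on S' p -> ~ vanishes_on S p -> (real_dim S' < real_dim S)%E.
Proof.
move=> S'S S0 irr pS' pS; have [I IE] := vanishing_prime S0 irr.
have extend k P : prime_chain S' k P -> (k.+1%:R%:E <= real_dim S)%E.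
  move=> [P0 PS]; apply: ereal_sup_ubound; exists k.+1 => //=.
  exists (fun i => if i is i'.+1 then P i' else I); split.
    by move=> f; rewrite IE => /asboolP.
  move=> [_|i ik]; last exact: PS.
  split; last by exists p; [exact: P0 | rewrite IE; apply/asboolP].
  by move=> f; rewrite IE => /asboolP Sf; apply: P0 => x /S'S; exact: Sf.
have dim_ge0 : (0 <= real_dim S)%E.
  apply: ereal_sup_ubound; exists 0%N => //=; exists (fun=> I); split=> //.
  by move=> f; rewrite IE => /asboolP.
have [[k0 k0P]|nochain] :=
  pselect (exists k, `[< exists P, prime_chain S' k P >]); last first.
  rewrite [X in (X < _)%E](_ : _ = -oo%E) ?(lt_le_trans _ dim_ge0) ?ltNyr //.
  rewrite /real_dim (_ : [set _ | _ in _] = set0) ?ereal_sup0 //.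
  apply/seteqP; split=> // x [k [P kP] _]; apply: nochain; exists k; apply/asboolP.
  by exists P.
have kn k : `[< exists P, prime_chain S' k P >] -> (k <= n)%N.
  by move=> /asboolP[P /prime_chain_le].
have [k /asboolP[P kP] kmax] := ex_maxnP (ex_intro _ k0 k0P) kn.
apply: (@le_lt_trans _ _ (k%:R%:E)); last first.
  by apply: lt_le_trans (extend _ _ kP); rewrite lte_fin ltr_nat.
apply: ub_ereal_sup => _ [j [Q jQ] <-]; rewrite lee_fin ler_nat.
by apply: kmax; apply/asboolP; exists Q.
Qed.

End KrullDimension.

(** * Irreducibility of the models and conclusion *)

Section Irreducible.
Context {R : realType}.
Variables (N d : nat) (sym : 'I_N -> bool) (r : 'I_N -> nat).
Hypothesis r_le : forall j, (r j <= d)%N.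

Local Notation coord := ('I_N * (bool * ('I_d * 'I_d)))%type.
Implicit Types (w : coord -> R).

Definition models : set ('I_N -> 'M[R]_d) :=
  [set A | forall j, model_mx (sym j) (r j) (A j)].

Let params1 w j : chart_idx d -> R := fun k => w (j, k).
Let chart_of w j := chart (sym j) (r j) (params1 w j).
Let den w := \prod_j chart_den (sym j) (r j) (params1 w j).
Let detT w := \prod_j \det (chartT (sym j) (r j) (params1 w j)).

Let poly_params j k : polyon (enum {: coord}) (fun w => params1 w j k).
Proof. by apply: polyon_var; rewrite mem_enum. Qed.

Let poly_detT : polyon (enum {: coord}) detT.
Proof.
by apply: polyfun_prod => j; apply: polyfun_det; apply: polymx_chartT => k;
  exact: poly_params.
Qed.

Let poly_den : polyon (enum {: coord}) den.
Proof.
by apply: polyfun_prod => j; apply: polyfun_chart_den => k; exact: poly_params.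
Qed.

Let den_neq0 w : den w != 0 -> forall j, chart_den (sym j) (r j) (params1 w j) != 0.
Proof.
by move=> dw j; move: dw; rewrite /den (bigD1 j) //= mulf_eq0 negb_or => /andP[].
Qed.

Let chart_of_models w : den w != 0 -> models (chart_of w).
Proof. by move=> dw j; apply: chart_model => //; exact: den_neq0. Qed.

Let models_chart_of A : models A -> exists2 w, den w != 0 & chart_of w = A.
Proof.
move=> VA; have /choice[p pP] : forall j, exists p,
    chart_den (sym j) (r j) p != 0 /\ chart (sym j) (r j) p = A j.
  by move=> j; have [p p0 pA] := chart_surjective (r_le j) (VA j); exists p.
exists (fun k => p k.1 k.2).
  by rewrite prodf_seq_neq0; apply/allP => j _ /=; have [] := pP j.
by apply/funext => j; have [_ <-] := pP j.
Qed.

Let clear_denominators f : polyfun (mx_entries N d) f ->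
  exists e F, polyon (enum {: coord}) F /\
    forall w, den w != 0 -> F w = detT w ^+ e * f (chart_of w).
Proof.
elim=> [_ [[j [a b]] _ <-]|c|f1 f2 _ [e1 [F1 [p1 E1]]] _ [e2 [F2 [p2 E2]]]
  |f1 f2 _ [e1 [F1 [p1 E1]]] _ [e2 [F2 [p2 E2]]]].
- exists 1%N, (fun w =>
    (\prod_(i | i != j) \det (chartT (sym i) (r i) (params1 w i))) *
    chart_num (sym j) (r j) (params1 w j) a b); split.
    apply: polyfun_mul; last by apply: polymx_chart_num => k; exact: poly_params.
    by apply: polyfun_prod => i; apply: polyfun_det; apply: polymx_chartT => k;
      exact: poly_params.
  move=> w /den_neq0/(_ j); rewrite mulf_eq0 negb_or => /andP[Tj _].
  by rewrite chart_numE // mxE expr1 /detT [in RHS](bigD1 j) //=; ring.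
- by exists 0%N, (fun=> c); split=> [|w _]; [exact: polyfun_cst | rewrite mul1r].
- exists (e1 + e2)%N, (fun w => detT w ^+ e2 * F1 w + detT w ^+ e1 * F2 w); split.
    by apply: polyfun_add; apply: polyfun_mul => //; apply: polyfun_exp;
      exact: poly_detT.
  by move=> w dw; rewrite E1 // E2 // exprD; ring.
- exists (e1 + e2)%N, (fun w => F1 w * F2 w); split; first exact: polyfun_mul.
  by move=> w dw; rewrite E1 // E2 // exprD; ring.
Qed.

Let detT_neq0 w : den w != 0 -> detT w != 0.
Proof.
move=> /den_neq0 dw; rewrite prodf_seq_neq0; apply/allP => j _ /=.
by have := dw j; rewrite mulf_eq0 negb_or => /andP[].
Qed.

Lemma models_nonempty : exists A, models A.
Proof.
have /choice[p pP] : forall j, exists p : chart_idx d -> R,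
  chart_den (sym j) (r j) p != 0.
  by move=> j; exact: chart_den_nonzero.
exists (fun j => chart (sym j) (r j) (p j)) => j; exact: chart_model.
Qed.

(** The models are images of the complement of a hypersurface under a rational
    map, and polynomials in the parameters have no zero divisors. *)
Lemma models_irreducible f g : polyfun (mx_entries N d) f ->
  polyfun (mx_entries N d) g ->
  (exists2 A, models A & f A != 0) -> (exists2 A, models A & g A != 0) ->
  exists2 A, models A & f A * g A != 0.
Proof.
move=> /clear_denominators[e [F [pF FE]]] /clear_denominators[e' [G [pG GE]]].
move=> [_ /models_chart_of[w dw <-] fw] [_ /models_chart_of[v dv <-] gv].
have Fw : F w * den w != 0 by rewrite FE // !mulf_neq0 ?expf_neq0 ?detT_neq0.
have Gv : G v != 0 by rewrite GE // !mulf_neq0 ?expf_neq0 ?detT_neq0.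
have [u] := polyon_nonzero_mul (polyfun_mul pF poly_den) pG Fw Gv.
rewrite !mulf_eq0 !negb_or => /andP[/andP[Fu du] Gu].
exists (chart_of u); first exact: chart_of_models.
move: Fu Gu; rewrite FE // GE // !mulf_eq0 !negb_or => /andP[_ fu] /andP[_ gu].
exact/andP.
Qed.

End Irreducible.

Section Genericity.
Context {R : realType}.
Variables (N d : nat).
Local Notation K := #|{: 'I_N * ('I_d * 'I_d)}|.

Lemma polyfun_mpoly (f : ('I_N -> 'M[R]_d) -> R) : polyfun (mx_entries N d) f ->
  exists p : mpoly.mpoly K R, forall A, mpoly.meval (mx_coords A) p = f A.
Proof.
elim=> [_ [k _ <-]|c|a b _ [p pE] _ [q qE]|a b _ [p pE] _ [q qE]].
- exists (mpoly.mpolyX R (mpoly.mnm1 (enum_rank k))) => A.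
  by rewrite mpoly.mevalXU /mx_coords enum_rankK.
- by exists (mpoly.mpolyC _ c) => A; rewrite mpoly.mevalC.
- by exists (p + q) => A; rewrite mpoly.mevalD pE qE.
- by exists (p * q) => A; rewrite mpoly.mevalM pE qE.
Qed.

Lemma mpoly_polyfun (p : mpoly.mpoly K R) :
  polyfun (mx_entries N d) (fun A => mpoly.meval (mx_coords A) p).
Proof.
apply: (@polyfun_eq _ _ _ (fun A => \sum_(m <- mpoly.msupp p)
  mpoly.mcoeff m p * \prod_i mx_coords A i ^+ m i)); last first.
  by move=> A; rewrite mpoly.mevalE.
apply: polyfun_sum => m; apply: polyfun_mul; first exact: polyfun_cst.
apply: polyfun_prod => i; apply: polyfun_exp; apply: polyfun_gen.
by exists (enum_val i).
Qed.

Lemma generic_in_models (sym : 'I_N -> bool) (r : 'I_N -> nat)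
    (Q : set ('I_N -> 'M[R]_d)) F :
  (forall j, (r j <= d)%N) -> polyfun (mx_entries N d) F ->
  (exists2 A, models sym r A & F A != 0) ->
  (forall A, models sym r A -> F A != 0 -> Q A) ->
  generic_in (models sym r) Q.
Proof.
move=> r_le /polyfun_mpoly[p pE] [A0 VA0 FA0] FQ; exists [:: p]; split; last first.
  move=> A VA nZ; apply: FQ => //; apply/eqP => FA; apply: nZ; split;
    first by exists A.
  by move=> q; rewrite inE => /eqP ->; rewrite pE.
apply: (@real_dim_drop _ _ _ _ p) => //.
- by exists (mx_coords A0); exists A0.
- move=> f g [_ [A VA <-] fA] [_ [B VB <-] gB].
  have [C VC fgC] := models_irreducible r_le (mpoly_polyfun f) (mpoly_polyfun g)
    (ex_intro2 _ _ A VA fA) (ex_intro2 _ _ B VB gB).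
  by exists (mx_coords C) => //; exists C.
- by move=> x [_ Zx]; apply: Zx; rewrite mem_head.
- move=> pV; case/eqP: FA0; rewrite -pE; apply: pV; by exists A0.
Qed.

End Genericity.

(** For d = 1 a single nonzero scalar suffices, since x^2 = y^2 forces y = x or
    y = - x. *)
Lemma scalar_ae_phase_retrieval (R : realType) N (A : 'I_N -> 'M[R]_1) j :
  A j 0 0 != 0 -> ae_phase_retrieval A.
Proof.
move=> Aj; apply: aeW => t y /(@quad_measP _ _ _ _ _ _ j).
set x := cV_of_tuple t => E.
have : (x 0 0 - y 0 0) * (x 0 0 + y 0 0) = 0.
  apply: (mulIf Aj); rewrite mul0r.
  have quad1 (z : 'cV[R]_1) : (z^T *m A j *m z) 0 0 = z 0 0 * A j 0 0 * z 0 0.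
    by rewrite mxE big_ord1 mxE big_ord1 mxE.
  move: E; rewrite !quad1 => /eqP; rewrite -subr_eq0 => /eqP <-; ring.
move=> /eqP; rewrite mulf_eq0 subr_eq0 addr_eq0 => /orP[] /eqP xy; [left|right].
  by apply/matrixP => a b; rewrite !ord1 xy.
by apply/matrixP => a b; rewrite !ord1 mxE xy opprK.
Qed.

Theorem theorem1p1 (R : realType) (d N : nat) (hN : (d + 1 <= N)%N) :
  (forall (dT : measure_display) (T : measurableType dT) (P : probability T R)
      (A : T -> 'I_N -> 'M[R]_d),
    abs_cont_random_sym P A ->
    {ae P, forall w, ae_phase_retrieval (A w)})
  /\
  (forall (r : 'I_N -> nat) (V : 'I_N -> set 'M[R]_d),
    (forall j, (1 <= r j <= d)%N) ->
    (forall j, V j = sym_rank_mx d (r j) \/ V j = proj_rank_mx d (r j)) ->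
    ((1 < d)%N -> (d <= nonidentity_count V)%N) ->
    generic_in [set A | forall j, V j (A j)]
      [set A | ae_phase_retrieval A]).
Proof.
have dN : (d < N)%N by rewrite -addn1.
split=> [dT T P A|r V rP VP nid]; first exact: random_symmetric_ae_phase_retrieval.
have r_gt0 j : (0 < r j)%N by have /andP[] := rP j.
have r_le j : (r j <= d)%N by have /andP[] := rP j.
pose sym j := `[< V j = sym_rank_mx d (r j) >].
have VE j : V j = model_mx (sym j) (r j).
  rewrite /model_mx /sym; case: asboolP => [//|nsym].
  by case: (VP j).
rewrite (_ : [set A | _] = models sym r); last first.
  by apply/seteqP; split=> A VA j; move: (VA j); rewrite VE.
have d_gt0 : (0 < d)%N.
  have j : 'I_N := Ordinal (leq_ltn_trans (leq0n d) dN).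
  exact: leq_trans (r_gt0 j) (r_le j).
have [d_gt1|d_le1] := ltnP 1 d.
  have nonid_ge : (d <= #|nonid d sym r|)%N.
    apply: leq_trans (nid d_gt1) _; apply: subset_leq_card;
      apply/fintype.subsetP => j.
    rewrite !inE => /asboolP Vj; apply: contrapT => /negP.
    rewrite negb_or -leqNgt => /andP[sj rj]; move/asboolP : Vj; apply.
    have rd : r j = d by apply/eqP; rewrite eqn_leq r_le.
    rewrite VE /model_mx (negbTE sj) rd; apply/seteqP; split=> M.
      exact: proj_full_rank.
    by move=> ->; split; rewrite ?trmx1 ?mulmx1 ?mxrank1.
  have [F [pF F0 FP]] := @generic_ae_phase_retrieval R N d sym r r_gt0 r_le d_gt0
    dN nonid_ge.
  exact: generic_in_models pF F0 FP.
have d1 : d = 1%N by apply/eqP; rewrite eqn_leq d_le1.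
have [A0 VA0] := @models_nonempty R N d sym r r_le.
apply: (@generic_in_models R N d sym r _ (fun=> 1)) => //.
- exact: polyfun_cst.
- by exists A0 => //; exact: oner_neq0.
move=> A VA _.
pose j0 : 'I_N := Ordinal (leq_ltn_trans (leq0n d) dN).
have rk : \rank (A j0) = 1%N.
  have := VA j0; rewrite /model_mx.
  have -> : r j0 = 1%N by apply/eqP; rewrite eqn_leq r_gt0 -d1 r_le.
  by case: (sym j0) => -[].
move: A {VA} rk; rewrite d1 => A rk; apply: (@scalar_ae_phase_retrieval _ _ _ j0).
apply: contra_eq_neq rk => A0j.
rewrite (_ : A j0 = 0) ?mxrank0 //; apply/matrixP => a b.
by rewrite !ord1 mxE.
Qed.
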